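(* Let $(\mathfrak X,\mathcal B_{\mathfrak X},\mu_{\mathfrak X})$ and $(\mathfrak Y,\mathcal B_{\mathfrak Y},\mu_{\mathfrak Y})$ be finite measure spaces, let $\mathfrak D$ be a notion of dependence on $\mathcal P$ (in the sense of the context), and let $\pi$ and $\pi^*$ be two distributions in $\overline{\mathcal P}$, with $X$- and $Y$-marginals of $\pi$ denoted $\pi_X$ and $\pi_Y$. Then $\pi$ and $\pi^*$ admit the same dependence, $\mathfrak D(\pi)=\mathfrak D(\pi^* )$, if and only if there exist (a.e.-)positive functions $\alpha^*\in L_1(\mathfrak X,\pi_X)$ and $\beta^*\in L_1(\mathfrak Y,\pi_Y)$ such that $$\frac{d\pi^*}{d\pi}(x,y)=\alpha^*(x)\,\beta^*(y).$$
   Context: Setting. $\mathcal P$ denotes the set of all probability distributions on $(\mathfrak X\times\mathfrak Y,\mathcal B_{\mathfrak X}\otimes\mathcal B_{\mathfrak Y})$ that are absolutely continuous with respect to $\mu_{\mathfrak X}\times\mu_{\mathfrak Y}$. For $\pi\in\mathcal P$: $\pi_X,\pi_Y$ are its marginals; $\varphi=d\pi/d(\mu_{\mathfrak X}\times\mu_{\mathfrak Y})$, $\varphi_X=d\pi_X/d\mu_{\mathfrak X}$, $\varphi_Y=d\pi_Y/d\mu_{\mathfrak Y}$ are the joint and marginal densities; the supports are $S_{XY}=\{\varphi>0\}$, $S_X=\{\varphi_X>0\}$, $S_Y=\{\varphi_Y>0\}$ (all understood up to null sets of the reference measures). The conditional densities are $\varphi_{Y|X}=d\pi/d(\pi_X\times\mu_{\mathfrak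 Y})$ on $S_X\times\mathfrak Y$ and $\varphi_{X|Y}=d\pi/d(\mu_{\mathfrak X}\times\pi_Y)$ on $\mathfrak X\times S_Y$. Two distributions share the same $Y|X$-conditional density if they have the same $S_X$ and the same $\varphi_{Y|X}$ a.e. on $S_X\times\mathfrak Y$ (similarly for $X|Y$). The Fréchet class $\mathcal F(\rho,\sigma)$ is the set of bivariate distributions with $X$-marginal $\rho$ and $Y$-marginal $\sigma$. The set $\overline{\mathcal P}$. It consists of the $\pi\in\mathcal P$ such that: (1) $\varphi\in L_\infty(\mathfrak X\times\mathfrak Y,\mu_{\mathfrak X}\times\mu_{\mathfrak Y})$; (2) there exist finitely many measurable rectangles $E_i\times F_i$ ($i=1,\dots,m$) and $G_j\times H_j$ ($j=1,\dots,n$) of positive $(\mu_{\mathfrak X}\times\mu_{\mathfrak Y})$-measure, with $S_X=\bigcup_{i}E_i$ and $S_Y=\bigcup_j H_j$ up to null sets, and a constant $c>0$ such that $\varphi\ge c$ a.e. on $\bigcup_i(E_i\times F_i)$ and on $\bigcup_j(G_j\times H_j)$; (3) there exist measurable sets $K_j\in\mathcal B_{\mathfrak X}\otimes\mathcal B_{\mathfrak Y}$ and scalars $\varepsilon_j>0$ ($j=1,2,\dots$) with $\varepsilon_j\to0$ such that $\varphi>\varepsilon_j$ a.e. on $K_j$, each $K_j$ is a countable union of measurable rectangles, and $S_{XY}=\bigcup_{j\ge1}K_j$. Dependence. The dependence of $\pi\in\mathcal P$ is the information necessary and sufficient to identify $\pi$ within its Fréchet class $\mathcal F(\pi_X,\pi_Y)$.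 Formally, a notion of dependence is an assignment $\pi\mapsto\mathfrak D(\pi)$ on $\mathcal P$ such that: (D1) if $\pi^{(1)},\pi^{(2)}\in\mathcal P$ share the same $Y|X$-conditional density, or share the same $X|Y$-conditional density, then $\mathfrak D(\pi^{(1)})=\mathfrak D(\pi^{(2)})$; (D2) if $\pi^{(1)},\pi^{(2)}\in\mathcal P$ belong to the same Fréchet class and $\mathfrak D(\pi^{(1)})=\mathfrak D(\pi^{(2)})$, then $\pi^{(1)}=\pi^{(2)}$; (D3) if $\mathfrak D(\pi^{(1)})=\mathfrak D(\pi^{(2)})$, then $S^{(1)}_{XY}=S^{(2)}_{XY}$ up to null sets. *)

(* Defs.v *)
From HB Require Import structures.
From mathcomp Require Import all_boot all_order all_algebra.
From mathcomp Require Import all_classical all_reals all_analysis.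
Set Implicit Arguments.
Unset Strict Implicit.
Unset Printing Implicit Defensive.
Import Order.TTheory GRing.Theory Num.Theory.
Import numFieldNormedType.Exports.
Local Open Scope classical_set_scope.
Local Open Scope ring_scope.
Local Open Scope ereal_scope.
Local Open Scope charge_scope.

(* A measure of the library is a function on all sets, constrained only on the
   measurable ones; two distributions are identified when they agree there. *)
Definition same_measure d (T : measurableType d) (R : realType)
    (m1 m2 : set T -> \bar R) : Prop :=
  forall A, measurable A -> m1 A = m2 A.

Definition same_set_ae d (T : measurableType d) (R : realType)
    (mu : {measure set T -> \bar R}) (A B : set T) : Prop :=
  {ae mu, forall x, A x <-> B x}.

(* Real-valued representative of dnu/dmu. The library's derivative is
   finite everywhere when nu `<< mu, so that [fine] loses nothing. This holds in
   all uses below; in particular p `<< muX \x muY implies p `<< p_X \x muY and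
   p `<< muX \x p_Y. *)
Definition density d (T : measurableType d) (R : realType)
    (nu : {finite_measure set T -> \bar R})
    (mu : {sigma_finite_measure set T -> \bar R}) : T -> R :=
  fun x => fine ('d (charge_of_finite_measure nu) '/d mu x).

(* Product measure under its own name: the library attaches a canonical
   sigma-finite structure to [\x] only for pairs of subprobabilities. *)
Section FiniteProduct.
Context d1 d2 (X : measurableType d1) (Y : measurableType d2) (R : realType).
Variables (m1 : {finite_measure set X -> \bar R})
          (m2 : {finite_measure set Y -> \bar R}).

Definition prod_measure : set (X * Y) -> \bar R := m1 \x m2.

HB.instance Definition _ := Measure.on prod_measure.

Let prod_measure_finite : fin_num_fun prod_measure.
Proof.
apply: lty_fin_num_fun; rewrite -setXTT.
rewrite [ltLHS](product_measure1E m1 m2 measurableT measurableT).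
by rewrite lte_mul_pinfty ?measure_ge0 ?fin_num_measure// ltey_eq fin_num_measure.
Qed.

HB.instance Definition _ :=
  Measure_isFinite.Build _ _ _ prod_measure prod_measure_finite.

End FiniteProduct.

Section Bivariate.
Context d1 d2 (X : measurableType d1) (Y : measurableType d2) (R : realType).

HB.instance Definition _ :=
  isMeasurableFun.Build _ _ (X * Y)%type X fst measurable_fst.
HB.instance Definition _ :=
  isMeasurableFun.Build _ _ (X * Y)%type Y snd measurable_snd.

Definition marginalX (p : probability (X * Y)%type R) : probability X R :=
  distribution p (fst : {mfun (X * Y)%type >-> X}).

Definition marginalY (p : probability (X * Y)%type R) : probability Y R :=
  distribution p (snd : {mfun (X * Y)%type >-> Y}).

Definition Frechet (rho : probability X R) (sigma : probability Y R) :
    set (probability (X * Y)%type R) :=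
  [set p | same_measure (marginalX p) rho /\ same_measure (marginalY p) sigma].

Variables (muX : {finite_measure set X -> \bar R})
          (muY : {finite_measure set Y -> \bar R}).

Record ac_distribution := AcDistribution {
  ac_prob :> probability (X * Y)%type R ;
  ac_dominated : ac_prob `<< prod_measure muX muY }.

Local Notation muXY := (prod_measure muX muY).

Implicit Types p q : ac_distribution.

Definition phi p : X * Y -> R := density p muXY.
Definition phiX p : X -> R := density (marginalX p) muX.
Definition phiY p : Y -> R := density (marginalY p) muY.

Definition SXY p : set (X * Y) := [set z | (0 < phi p z)%R].
Definition SX p : set X := [set x | (0 < phiX p x)%R].
Definition SY p : set Y := [set y | (0 < phiY p y)%R].

Definition phiY_X p : X * Y -> R := density p (prod_measure (marginalX p) muY).
Definition phiX_Y p : X * Y -> R := density p (prod_measure muX (marginalY p)).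

Definition share_Y_X p q : Prop :=
  same_set_ae muX (SX p) (SX q) /\
  phiY_X p = phiY_X q %[ae muXY in SX p `*` setT].

Definition share_X_Y p q : Prop :=
  same_set_ae muY (SY p) (SY q) /\
  phiX_Y p = phiX_Y q %[ae muXY in setT `*` SY p].

Record is_dependence (D : Type) (dep : ac_distribution -> D) : Prop := {
  dep_conditional : forall p q,
    share_Y_X p q \/ share_X_Y p q -> dep p = dep q ;
  dep_identifies : forall rho sigma p q,
    Frechet rho sigma p -> Frechet rho sigma q ->
    dep p = dep q -> same_measure p q ;
  dep_support : forall p q,
    dep p = dep q -> same_set_ae muXY (SXY p) (SXY q) }.

Definition bounded_below_on_rectangles p : Prop :=
  exists (m n : nat) (E : 'I_m -> set X) (F : 'I_m -> set Y)
    (G : 'I_n -> set X) (H : 'I_n -> set Y) (c : R),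
  [/\ forall i, [/\ measurable (E i), measurable (F i)
                  & 0 < muXY (E i `*` F i)],
      forall j, [/\ measurable (G j), measurable (H j)
                  & 0 < muXY (G j `*` H j)],
      same_set_ae muX (SX p) (\bigcup_i E i) /\
      same_set_ae muY (SY p) (\bigcup_j H j),
      (0 < c)%R
    & {ae muXY, forall z,
         (\bigcup_i (E i `*` F i)) z -> (c <= phi p z)%R} /\
      {ae muXY, forall z,
         (\bigcup_j (G j `*` H j)) z -> (c <= phi p z)%R}].

Definition countable_union_of_rectangles (K : set (X * Y)) : Prop :=
  exists (A : nat -> set X) (B : nat -> set Y),
  [/\ forall k, measurable (A k), forall k, measurable (B k)
    & K = \bigcup_k (A k `*` B k)].

Definition support_exhausted_by_rectangles p : Prop :=
  exists (K : nat -> set (X * Y)) (eps : nat -> R),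
  [/\ forall j, measurable (K j) /\ countable_union_of_rectangles (K j),
      forall j, (0 < eps j)%R,
      eps @ \oo --> (0 : R)%R,
      forall j, {ae muXY, forall z, K j z -> (eps j < phi p z)%R}
    & same_set_ae muXY (SXY p) (\bigcup_j K j)].

Definition Pbar : set ac_distribution :=
  [set p | [/\ phi p \in Lfun muXY +oo,
               bounded_below_on_rectangles p
             & support_exhausted_by_rectangles p]].

End Bivariate.

(* Main.v *)
Require Import Defs.
From HB Require Import structures.
From mathcomp Require Import all_boot all_order all_algebra.
From mathcomp Require Import all_classical all_reals all_analysis.
From mathcomp Require Import measurable_realfun ess_sup_inf.
From mathcomp Require Import ring lra.
Set Implicit Arguments.
Unset Strict Implicit.
Unset Printing Implicit Defensive.
Import Order.TTheory GRing.Theory Num.Theory.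
Import numFieldNormedType.Exports.
Local Open Scope classical_set_scope.
Local Open Scope ring_scope.

(** Write f and g for the joint densities of the two distributions p and q.

    If dq/dp = alpha(x) beta(y), go from p to q in two steps. Reweighting p by
    alpha(x), normalized, multiplies f(x, y) and the X-marginal density at x by
    the same factor, so the Y|X-conditional density, which is their ratio,
    does not move. Reweighting the result by beta(y) preserves the
    X|Y-conditional density in the same way. Both steps preserve the
    dependence: [dep_product_density].

    Conversely, let p and q have the same dependence. Suppose that alpha(x)
    and beta(y) are found such that alpha beta p has the marginals of q. By the
    first part alpha beta p has the dependence of p, hence that of q, and it
    lies in the Frechet class of q; so it is q. Everything thus rests on a
    scaling theorem, [marginal_scaling]: if f and g are bounded, have the same
    support, and f >= c > 0 on enough rectangles, then some
    f(x, y) exp(u(x) + v(y)) has the marginals of g. These are the stationarity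
    equations of the convex functional

      J(w) = int (f exp w - g w)    over   w(x, y) = u(x) + v(y),

    and J is minimized over bounded u and v.

    - A lower bound for J would follow from a bound on g/f, which is unbounded
      in general. But J(w) depends on g through its marginals only, so g can be
      replaced by any h with the same marginals: [competitor] constructs one
      with 0 < h <= C f on the support. The part of g in excess of C f, where f
      is small, is moved onto the rectangles on which f >= c ([reroute]).
    - The identity J(w1) + J(w2) - 2 J((w1 + w2)/2) =
      int f (exp(w1/2) - exp(w2/2))^2 makes exp(w_n/2) a Cauchy sequence in
      L^2(f) for every minimizing sequence w_n = u_n + v_n, so that w_n
      converges almost everywhere on the support to some w, and the marginals
      pass to the limit: [entropy_projection].
    - The limit w is again of the form u(x) + v(y). On a rectangle E_i x F_i
      contained in the support, a section of w gives the limit of u_n up to an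
      additive constant depending on n and i. Only finitely many such constants
      occur, and a linear map between finite-dimensional spaces has a closed
      image, so that they can be renormalized: [split_limits] and
      [additive_limit].

    Finally alpha = exp u is integrable, since the mass of
    alpha beta p on E_i x F_i is at least c (int_{E_i} alpha) (int_{F_i} beta),
    and the E_i cover the X-support: [left_factor_integrable]. *)

(** * Bounded measurable functions and their integrals *)

Section BoundedMeasurable.
Context d (T : measurableType d) (R : realType).
Implicit Types f g : T -> R.

(** Bounded measurable functions form an algebra stable under exponentials and,
    on a finite measure space, under taking marginals; all their integrals are
    real numbers. Lemma names abbreviate the predicate to bm. *)
Definition bounded_mfun f := measurable_fun setT f /\ exists M, forall x, `|f x| <= M.

Lemma bm_meas f : bounded_mfun f -> measurable_fun setT f. Proof. by case. Qed.

Lemma bm_bound f : bounded_mfun f -> exists M, 0 < M /\ forall x, `|f x| <= M.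
Proof.
case=> _ [M fM]; exists (`|M| + 1); split; first by rewrite ltr_wpDl.
by move=> x; rewrite (le_trans (fM x))// (le_trans (ler_norm M))// lerDl.
Qed.

Lemma bm_cst (c : R) : bounded_mfun (fun=> c).
Proof. by split; [exact: measurable_cst|exists `|c|]. Qed.

Lemma bmD f g : bounded_mfun f -> bounded_mfun g -> bounded_mfun (fun x => f x + g x).
Proof.
move=> [mf [M fM]] [mg [N gN]]; split; first exact: measurable_funD.
by exists (M + N) => x; rewrite (le_trans (ler_normD _ _))// lerD.
Qed.

Lemma bmN f : bounded_mfun f -> bounded_mfun (fun x => - f x).
Proof.
move=> [mf [M fM]]; split; first exact: measurableT_comp.
by exists M => x; rewrite normrN.
Qed.

Lemma bmM f g : bounded_mfun f -> bounded_mfun g -> bounded_mfun (fun x => f x * g x).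
Proof.
move=> [mf [M fM]] [mg [N gN]]; split; first exact: measurable_funM.
by exists (M * N) => x; rewrite normrM ler_pM.
Qed.

Lemma bm_exp2 f : bounded_mfun f -> bounded_mfun (fun x => f x ^+ 2).
Proof. exact: (fun bf => bmM bf bf). Qed.

Lemma bm_norm f : bounded_mfun f -> bounded_mfun (fun x => `|f x|).
Proof.
move=> [mf [M fM]]; split; first exact: measurableT_comp.
by exists M => x; rewrite normr_id.
Qed.

Lemma bm_max f g : bounded_mfun f -> bounded_mfun g -> bounded_mfun (fun x => Num.max (f x) (g x)).
Proof.
move=> [mf [M fM]] [mg [N gN]]; split; first exact: measurable_maxr.
exists (Num.max M N) => x.
by rewrite le_max; case: (leP (f x) (g x)) => _; rewrite ?fM ?gN ?orbT.
Qed.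

Lemma bm_min f g : bounded_mfun f -> bounded_mfun g -> bounded_mfun (fun x => Num.min (f x) (g x)).
Proof.
move=> [mf [M fM]] [mg [N gN]]; split; first exact: measurable_minr.
exists (Num.max M N) => x.
by rewrite le_max; case: (leP (f x) (g x)) => _; rewrite ?fM ?gN ?orbT.
Qed.

Lemma bm_expR f : bounded_mfun f -> bounded_mfun (fun x => expR (f x)).
Proof.
move=> [mf [M fM]]; split; first exact: measurableT_comp.
exists (expR M) => x; rewrite ger0_norm ?expR_ge0// ler_expR.
by rewrite (le_trans (ler_norm _)).
Qed.

Lemma bm_indic (A : set T) : measurable A -> bounded_mfun (\1_A : T -> R).
Proof.
move=> mA; split; first exact: measurable_indic.
by exists 1 => x; rewrite indicE ger0_norm// lern1 leq_b1.
Qed.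

Lemma bm_sum (I : Type) (s : seq I) (P : pred I) (F : I -> T -> R) :
  (forall i, bounded_mfun (F i)) -> bounded_mfun (fun x => \sum_(i <- s | P i) F i x).
Proof.
move=> bF; elim: s => [|i s ih].
  have -> : (fun x => \sum_(i <- [::] | P i) F i x) = (fun=> 0 : R).
    by apply/funext => x; rewrite big_nil.
  exact: bm_cst.
have -> : (fun x => \sum_(i <- i :: s | P i) F i x) =
    (fun x => (if P i then F i x else 0) + \sum_(j <- s | P j) F j x).
  by apply/funext => x; rewrite big_cons; case: ifP; rewrite ?add0r.
by case: (P i); apply: bmD => //; exact: bm_cst.
Qed.

End BoundedMeasurable.

Lemma bm_comp d1 d2 (T1 : measurableType d1) (T2 : measurableType d2)
    (R : realType) (h : T1 -> T2) (f : T2 -> R) :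
  measurable_fun setT h -> bounded_mfun f -> bounded_mfun (fun x => f (h x)).
Proof.
move=> mh [mf [M fM]]; split; first exact: (measurableT_comp mf).
by exists M.
Qed.

Lemma bm_fst d1 d2 (X : measurableType d1) (Y : measurableType d2)
    (R : realType) (u : X -> R) : bounded_mfun u -> bounded_mfun (fun z : X * Y => u z.1).
Proof. by apply: bm_comp; exact: measurable_fst. Qed.

Lemma bm_snd d1 d2 (X : measurableType d1) (Y : measurableType d2)
    (R : realType) (v : Y -> R) : bounded_mfun v -> bounded_mfun (fun z : X * Y => v z.2).
Proof. by apply: bm_comp; exact: measurable_snd. Qed.

Lemma bm_pair1 d1 d2 (X : measurableType d1) (Y : measurableType d2)
    (R : realType) (f : X * Y -> R) x : bounded_mfun f -> bounded_mfun (fun y => f (x, y)).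
Proof. by apply: (@bm_comp _ _ _ _ _ (pair x)); exact: pair1_measurable. Qed.

Lemma bm_pair2 d1 d2 (X : measurableType d1) (Y : measurableType d2)
    (R : realType) (f : X * Y -> R) y : bounded_mfun f -> bounded_mfun (fun x => f (x, y)).
Proof. by apply: (@bm_comp _ _ _ _ _ (pair^~ y)); exact: pair2_measurable. Qed.

(** Follows the syntax of the function. Matching up to conversion instead would
    unfold the marginals, that is, integrals, occurring in the functions. *)
Ltac bounded_mfun_tac := repeat first
  [ match goal with H : bounded_mfun ?f |- bounded_mfun ?f => exact H end
  | lazymatch goal with
    | |- bounded_mfun (fun z => ?u z) => change (bounded_mfun u)
    | |- bounded_mfun (fun _ => ?c) => exact: (bm_cst _ c)
    | |- bounded_mfun (fun z => ?u (fst z)) => apply: (@bm_fst _ _ _ _ _ u)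
    | |- bounded_mfun (fun z => ?v (snd z)) => apply: (@bm_snd _ _ _ _ _ v)
    | |- bounded_mfun (fun z => @?f z + @?g z) => apply: (@bmD _ _ _ f g)
    | |- bounded_mfun (fun z => - @?f z) => apply: (@bmN _ _ _ f)
    | |- bounded_mfun (fun z => @?f z * @?g z) => apply: (@bmM _ _ _ f g)
    | |- bounded_mfun (fun z => @?f z ^+ 2) => apply: (@bm_exp2 _ _ _ f)
    | |- bounded_mfun (fun z => `|@?f z|) => apply: (@bm_norm _ _ _ f)
    | |- bounded_mfun (fun z => Num.max (@?f z) (@?g z)) => apply: (@bm_max _ _ _ f g)
    | |- bounded_mfun (fun z => Num.min (@?f z) (@?g z)) => apply: (@bm_min _ _ _ f g)
    | |- bounded_mfun (fun z => expR (@?f z)) => apply: (@bm_expR _ _ _ f)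
    | |- bounded_mfun (\1_ _) => apply: bm_indic
    | |- bounded_mfun (fun z => bigop.body _ _ _) => apply: bm_sum => ?
    | H : forall _, bounded_mfun _ |- bounded_mfun _ => apply: H
    end ].

Section RealIntegral.
Context d (T : measurableType d) (R : realType).
Variable mu : {finite_measure set T -> \bar R}.
Implicit Types f g : T -> R.

Lemma bm_integrable f (A : set T) : measurable A -> bounded_mfun f ->
  mu.-integrable A (EFin \o f).
Proof.
move=> mA [mf [M fM]]; apply: (integrableS measurableT) => //.
apply: measurable_bounded_integrable => //.
- by rewrite ltey_eq fin_num_measure.
- exists M; split; first exact: num_real.
  by move=> N MN x _; exact: le_trans (fM x) (ltW MN).
Qed.

Lemma bm_EFin f (A : set T) : measurable A -> bounded_mfun f ->
  (\int[mu]_(x in A) (f x)%:E)%E = (\int[mu]_(x in A) f x)%:E.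
Proof.
by move=> mA bf; rewrite /Rintegral fineK// integrable_fin_num//; exact: bm_integrable.
Qed.

Lemma bm_intD f g (A : set T) : measurable A -> bounded_mfun f -> bounded_mfun g ->
  \int[mu]_(x in A) (f x + g x) = \int[mu]_(x in A) f x + \int[mu]_(x in A) g x.
Proof. by move=> mA bf bg; rewrite RintegralD//; exact: bm_integrable. Qed.

Lemma bm_intB f g (A : set T) : measurable A -> bounded_mfun f -> bounded_mfun g ->
  \int[mu]_(x in A) (f x - g x) = \int[mu]_(x in A) f x - \int[mu]_(x in A) g x.
Proof. by move=> mA bf bg; rewrite RintegralB//; exact: bm_integrable. Qed.

Lemma bm_intZ c f (A : set T) : measurable A -> bounded_mfun f ->
  \int[mu]_(x in A) (c * f x) = c * \int[mu]_(x in A) f x.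
Proof. by move=> mA bf; rewrite RintegralZl//; exact: bm_integrable. Qed.

Lemma bm_int_sum (I : Type) (s : seq I) (P : pred I) (F : I -> T -> R) (A : set T) :
  measurable A -> (forall i, bounded_mfun (F i)) ->
  \int[mu]_(x in A) (\sum_(i <- s | P i) F i x) =
  \sum_(i <- s | P i) \int[mu]_(x in A) F i x.
Proof.
move=> mA bF; elim: s => [|i s ih].
  under eq_Rintegral do rewrite big_nil.
  by rewrite big_nil Rintegral_cst// mul0r.
under eq_Rintegral do rewrite big_cons.
rewrite big_cons; case: ifP => // _.
by rewrite bm_intD// ?ih//; exact: bm_sum.
Qed.

Lemma bm_int_ae f g (A : set T) : measurable A -> bounded_mfun f -> bounded_mfun g ->
  {ae mu, forall x, f x = g x} ->
  \int[mu]_(x in A) f x = \int[mu]_(x in A) g x.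
Proof.
move=> mA [mf _] [mg _] fg; congr fine; apply: ae_eq_integral => //.
- by apply/measurable_EFinP; exact: measurable_funTS.
- by apply/measurable_EFinP; exact: measurable_funTS.
- by apply: filterS fg => x -> _.
Qed.

Lemma bm_le_int f g (A : set T) : measurable A -> bounded_mfun f -> bounded_mfun g ->
  {ae mu, forall x, f x <= g x} ->
  \int[mu]_(x in A) f x <= \int[mu]_(x in A) g x.
Proof.
move=> mA bf bg fg.
rewrite -(@bm_int_ae (fun x => Num.min (f x) (g x)) f)//; last 2 first.
- exact: bm_min.
- by apply: filterS fg => x xfg; apply/min_idPl.
apply: le_Rintegral => //; [exact/bm_integrable/bm_min|exact: bm_integrable|].
by move=> x _; rewrite ge_min lexx orbT.
Qed.

Lemma bm_int_eq0 f : bounded_mfun f -> (forall x, 0 <= f x) ->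
  \int[mu]_x f x = 0 -> {ae mu, forall x, f x = 0}.
Proof.
move=> bf f0 If0.
have : (\int[mu]_x `|(f x)%:E|)%E = 0%E.
  under eq_integral do rewrite gee0_abs ?lee_fin//.
  by rewrite bm_EFin// If0.
move/(ae_eq_integral_abs mu measurableT) => /(_ _)/wrap[].
  by apply/measurable_EFinP; case: bf.
by apply: filterS => x /(_ I) [].
Qed.

Lemma Rintegral_indic (A : set T) h : \int[mu]_(x in A) h x = \int[mu]_x (h x * \1_A x).
Proof.
rewrite Rintegral_mkcond; apply: eq_Rintegral => x _.
by rewrite patchE indicE; case: ifP; rewrite ?mulr1 ?mulr0.
Qed.

Lemma bm_int_ge0 f A : (forall x, 0 <= f x) -> 0 <= \int[mu]_(x in A) f x.
Proof. by move=> f0; apply: Rintegral_ge0. Qed.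

End RealIntegral.

(** * Marginals and sections on a product of finite measure spaces *)

Section ProductIntegral.
Context d1 d2 (X : measurableType d1) (Y : measurableType d2) (R : realType).
Variables (muX : {finite_measure set X -> \bar R})
          (muY : {finite_measure set Y -> \bar R}).
Local Notation muXY := (prod_measure muX muY).
Implicit Types (h : X * Y -> R) (u : X -> R) (v : Y -> R).

Definition margX h (x : X) : R := \int[muY]_y h (x, y).
Definition margY h (y : Y) : R := \int[muX]_x h (x, y).

Lemma margX_EFin h x : bounded_mfun h ->
  (margX h x)%:E = fubini_F muY (EFin \o h) x.
Proof. by move=> bh; rewrite /fubini_F/= (bm_EFin _ measurableT)//; exact: bm_pair1. Qed.

Lemma margY_EFin h y : bounded_mfun h ->
  (margY h y)%:E = fubini_G muX (EFin \o h) y.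
Proof. by move=> bh; rewrite /fubini_G/= (bm_EFin _ measurableT)//; exact: bm_pair2. Qed.

Lemma bm_margX h : bounded_mfun h -> bounded_mfun (margX h).
Proof.
move=> bh; split.
  have -> : margX h = fine \o fubini_F muY (EFin \o h).
    by apply/funext => x /=; rewrite -margX_EFin.
  apply: measurableT_comp => //.
  apply: measurable_fubini_F; exact: (bm_integrable muXY measurableT bh).
have [M [M0 hM]] := bm_bound bh.
exists (M * fine (muY setT)) => x.
rewrite (le_trans (le_normr_Rintegral _ _))//; first exact/bm_integrable/bm_pair1.
rewrite -(Rintegral_cst _ measurableT) bm_le_int//.
- exact/bm_norm/bm_pair1.
- exact: bm_cst.
- exact: aeW.
Qed.

Lemma bm_margY h : bounded_mfun h -> bounded_mfun (margY h).
Proof.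
move=> bh; split.
  have -> : margY h = fine \o fubini_G muX (EFin \o h).
    by apply/funext => y /=; rewrite -margY_EFin.
  apply: measurableT_comp => //.
  apply: measurable_fubini_G; exact: (bm_integrable muXY measurableT bh).
have [M [M0 hM]] := bm_bound bh.
exists (M * fine (muX setT)) => y.
rewrite (le_trans (le_normr_Rintegral _ _))//; first exact/bm_integrable/bm_pair2.
rewrite -(Rintegral_cst _ measurableT) bm_le_int//.
- exact/bm_norm/bm_pair2.
- exact: bm_cst.
- exact: aeW.
Qed.

Lemma margX_ge0 h x : (forall z, 0 <= h z) -> 0 <= margX h x.
Proof. by move=> h0; exact: bm_int_ge0. Qed.

Lemma margY_ge0 h y : (forall z, 0 <= h z) -> 0 <= margY h y.
Proof. by move=> h0; exact: bm_int_ge0. Qed.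

Lemma int_margX h : bounded_mfun h -> \int[muXY]_z h z = \int[muX]_x margX h x.
Proof.
move=> bh; congr fine.
have /= <- := @integral12_prod_meas1 _ _ _ _ _ muX muY _ (bm_integrable muXY measurableT bh).
by apply: eq_integral => x _; rewrite margX_EFin.
Qed.

Lemma int_margY h : bounded_mfun h -> \int[muXY]_z h z = \int[muY]_y margY h y.
Proof.
move=> bh; congr fine.
have /= <- := @integral21_prod_meas1 _ _ _ _ _ muX muY _ (bm_integrable muXY measurableT bh).
by apply: eq_integral => x _; rewrite margY_EFin.
Qed.

Lemma margXMr h u x : bounded_mfun h -> margX (fun z => h z * u z.1) x = margX h x * u x.
Proof.
move=> bh; rewrite /margX/= mulrC -bm_intZ//; last exact: bm_pair1.
by apply: eq_Rintegral => y _; rewrite mulrC.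
Qed.

Lemma margYMr h v y : bounded_mfun h -> margY (fun z => h z * v z.2) y = margY h y * v y.
Proof.
move=> bh; rewrite /margY/= mulrC -bm_intZ//; last exact: bm_pair2.
by apply: eq_Rintegral => x _; rewrite mulrC.
Qed.

Lemma int_margXMr h u : bounded_mfun h -> bounded_mfun u ->
  \int[muXY]_z (h z * u z.1) = \int[muX]_x (margX h x * u x).
Proof.
move=> bh bu; rewrite int_margX; last by bounded_mfun_tac.
by apply: eq_Rintegral => x _; rewrite margXMr.
Qed.

Lemma int_margYMr h v : bounded_mfun h -> bounded_mfun v ->
  \int[muXY]_z (h z * v z.2) = \int[muY]_y (margY h y * v y).
Proof.
move=> bh bv; rewrite int_margY; last by bounded_mfun_tac.
by apply: eq_Rintegral => x _; rewrite margYMr.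
Qed.

Lemma int_prod u v : bounded_mfun u -> bounded_mfun v ->
  \int[muXY]_z (u z.1 * v z.2) = (\int[muX]_x u x) * (\int[muY]_y v y).
Proof.
move=> bu bv; rewrite int_margX; last by bounded_mfun_tac.
rewrite mulrC -bm_intZ//; apply: eq_Rintegral => x _.
by rewrite /margX/= bm_intZ// mulrC.
Qed.

Lemma ae_fst (P : X -> Prop) :
  {ae muX, forall x, P x} -> {ae muXY, forall z, P z.1}.
Proof.
move=> [N [mN N0 PN]]; exists (N `*` setT); split.
- exact: measurableX.
- apply: etrans (product_measure1E muX muY mN measurableT) _.
  by apply/eqP; rewrite mule_eq0; apply/orP; left; apply/eqP.
- by move=> z /= Pz; split => //; apply: PN.
Qed.

Lemma ae_snd (P : Y -> Prop) :
  {ae muY, forall y, P y} -> {ae muXY, forall z, P z.2}.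
Proof.
move=> [N [mN N0 PN]]; exists (setT `*` N); split.
- exact: measurableX.
- apply: etrans (product_measure1E muX muY measurableT mN) _.
  by apply/eqP; rewrite mule_eq0; apply/orP; right; apply/eqP.
- by move=> z /= Pz; split => //; apply: PN.
Qed.

(** A null set of the product has null sections over almost every point, as its
    measure is the integral of the measures of its sections. *)
Lemma ae_section1 (P : X * Y -> Prop) : {ae muXY, forall z, P z} ->
  {ae muX, forall x, {ae muY, forall y, P (x, y)}}.
Proof.
move=> [N [mN N0 PN]].
have : (\int[muX]_x `|muY (xsection N x)|)%E = 0%E.
  by rewrite -[RHS]N0; apply: eq_integral => x _; rewrite gee0_abs.
move/(ae_eq_integral_abs muX measurableT) => /(_ _)/wrap[].
  exact: measurable_fun_xsection.
apply: filterS => x /(_ I) x0; exists (xsection N x); split => //.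
- exact: measurable_xsection.
- by move=> y /= Py; rewrite /xsection/= inE; exact: PN.
Qed.

Lemma ae_section2 (P : X * Y -> Prop) : {ae muXY, forall z, P z} ->
  {ae muY, forall y, {ae muX, forall x, P (x, y)}}.
Proof.
move=> [N [mN N0 PN]].
have N0' : ((muX \x^ muY) N = 0)%E.
  rewrite -[RHS]N0; apply/esym; apply: product_measure_unique => // A B mA mB.
  exact: product_measure2E.
have : (\int[muY]_y `|muX (ysection N y)|)%E = 0%E.
  by rewrite -[RHS]N0'; apply: eq_integral => x _; rewrite gee0_abs.
move/(ae_eq_integral_abs muY measurableT) => /(_ _)/wrap[].
  exact: measurable_fun_ysection.
apply: filterS => x /(_ I) x0; exists (ysection N x); split => //.
- exact: measurable_ysection.
- by move=> y /= Py; rewrite /ysection/= inE; exact: PN.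
Qed.

End ProductIntegral.

(** * Moving mass onto rectangles *)

Lemma ae_not_null d (T : measurableType d) (R : realType)
    (mu : {measure set T -> \bar R}) (A : set T) :
  measurable A -> (0 < mu A)%E -> ~ {ae mu, forall x, ~ A x}.
Proof.
move=> mA A0; rewrite /almost_everywhere/prop_near1/nbhs/=.
have -> : ~` [set x | ~ A x] = A.
  by apply/seteqP; split => y /=; [exact: contrapT|move=> Ay /(_ Ay)].
by move/(negligibleP mu mA) => A00; rewrite A00 ltxx in A0.
Qed.

Lemma indic_neq0 (T : Type) (R : realType) (A : set T) x :
  (\1_A x : R) != 0 -> A x.
Proof.
by rewrite indicE; case: (boolP (x \in A)) => [/set_mem//|_]; rewrite eqxx.
Qed.

(** Fix weights e on X, living on E, and eta on Y, living on H, and a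
    distribution of mass r (x, y) e (x) eta (y). The mass sitting at (x, y) can be
    sent to E x F and G x H, where f >= c, along a path of moves

      + (x, F)  - (E, F)  + (E, H)  - (G, H)  + (G, y),

    each term of which is a distribution of the total mass at hand. The first
    and last terms are products of marginals; the term + (E, H) is [lam], and the
    terms with a minus sign are [tau] and [sig], which have to be dominated by g.
    The weights are chosen for the marginals to match: [tau] has the X-marginal
    of [lam] and [sig] has its Y-marginal. *)
Section Reroute.
Context d1 d2 (X : measurableType d1) (Y : measurableType d2) (R : realType).
Variables (muX : {finite_measure set X -> \bar R})
          (muY : {finite_measure set Y -> \bar R}).
Local Notation muXY := (prod_measure muX muY).
Local Notation margX := (margX muY).
Local Notation margY := (margY muX).

(** Otherwise h would vanish at almost every point of F above x, while F is not
    null. *)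
Lemma ae_margX_gt0 (h : X * Y -> R) (E : set X) (F : set Y) :
  bounded_mfun h -> (forall z, 0 <= h z) -> measurable F -> (0 < muY F)%E ->
  {ae muXY, forall z, E z.1 -> F z.2 -> 0 < h z} ->
  {ae muX, forall x, E x -> 0 < margX (fun z => h z * \1_F z.2) x}.
Proof.
move=> bh h0 mF F0 /ae_section1; apply: filterS => x hx Ex.
rewrite lt_neqAle eq_sym margX_ge0 ?andbT; last first.
  by move=> z; rewrite mulr_ge0.
apply/eqP => I0; apply: (ae_not_null mF F0).
have h00 : {ae muY, forall y, h (x, y) * \1_F y = 0}.
  apply: bm_int_eq0 I0; last by move=> y; rewrite mulr_ge0.
  by apply: (@bm_pair1 _ _ _ _ _ (fun z => h z * \1_F z.2)); bounded_mfun_tac.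
apply: filterS2 hx h00 => y /(_ Ex)/= hx + Fy.
by move/eqP; rewrite indicE mem_set// mulr1 gt_eqF ?hx.
Qed.

Lemma ae_margY_gt0 (h : X * Y -> R) (G : set X) (H : set Y) :
  bounded_mfun h -> (forall z, 0 <= h z) -> measurable G -> (0 < muX G)%E ->
  {ae muXY, forall z, G z.1 -> H z.2 -> 0 < h z} ->
  {ae muY, forall y, H y -> 0 < margY (fun z => h z * \1_G z.1) y}.
Proof.
move=> bh h0 mG G0 /ae_section2; apply: filterS => y hy Hy.
rewrite lt_neqAle eq_sym margY_ge0 ?andbT; last first.
  by move=> z; rewrite mulr_ge0.
apply/eqP => I0; apply: (ae_not_null mG G0).
have h00 : {ae muX, forall x, h (x, y) * \1_G x = 0}.
  apply: bm_int_eq0 I0; last by move=> x; rewrite mulr_ge0.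
  by apply: (@bm_pair2 _ _ _ _ _ (fun z => h z * \1_G z.1)); bounded_mfun_tac.
apply: filterS2 hy h00 => x + + Gx => /(_ Gx Hy)/= hy.
by move/eqP; rewrite indicE mem_set// mulr1 gt_eqF ?hy.
Qed.

Variables (f g : X * Y -> R) (c : R) (e : X -> R) (eta : Y -> R).
Variables (E : set X) (F : set Y) (G : set X) (H : set Y).
Hypotheses (bf : bounded_mfun f) (bg : bounded_mfun g) (f0 : forall z, 0 <= f z)
  (g0 : forall z, 0 <= g z).
Hypothesis fg : {ae muXY, forall z, (0 < f z) <-> (0 < g z)}.
Hypothesis c0 : 0 < c.
Hypotheses (mF : measurable F) (mG : measurable G).
Hypotheses (F0 : (0 < muY F)%E) (G0 : (0 < muX G)%E).
Hypothesis fEF : {ae muXY, forall z, E z.1 -> F z.2 -> c <= f z}.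
Hypothesis fGH : {ae muXY, forall z, G z.1 -> H z.2 -> c <= f z}.
Hypotheses (be : bounded_mfun e) (beta : bounded_mfun eta).
Hypotheses (e0 : forall x, 0 <= e x) (eta0 : forall y, 0 <= eta y).
Hypotheses (eE : forall x, e x != 0 -> E x) (etaH : forall y, eta y != 0 -> H y).

(* Mass of g above x in F, and beside y in G; s and t below are the densities
   that make tau and sig match lam. *)
Let rhoE x := margX (fun z => g z * \1_F z.2) x.
Let rhoH y := margY (fun z => g z * \1_G z.1) y.
Let A x := e x * rhoE x.
Let B y := eta y * rhoH y.
Let lam z := f z * (A z.1 * B z.2).
Let s x := margX (fun z => f z * B z.2) x.
Let t y := margY (fun z => f z * A z.1) y.
Let tau z := (g z * \1_F z.2) * (e z.1 * s z.1).
Let sig z := (g z * \1_G z.1) * (eta z.2 * t z.2).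

Let brhoE : bounded_mfun rhoE. Proof. by apply: bm_margX; bounded_mfun_tac. Qed.
Let brhoH : bounded_mfun rhoH. Proof. by apply: bm_margY; bounded_mfun_tac. Qed.
Let bA : bounded_mfun A. Proof. by rewrite /A; bounded_mfun_tac. Qed.
Let bB : bounded_mfun B. Proof. by rewrite /B; bounded_mfun_tac. Qed.
Let blam : bounded_mfun lam. Proof. by rewrite /lam; bounded_mfun_tac. Qed.
Let bs : bounded_mfun s. Proof. by apply: bm_margX; bounded_mfun_tac. Qed.
Let bt : bounded_mfun t. Proof. by apply: bm_margY; bounded_mfun_tac. Qed.
Let btau : bounded_mfun tau. Proof. by rewrite /tau; bounded_mfun_tac. Qed.
Let bsig : bounded_mfun sig. Proof. by rewrite /sig; bounded_mfun_tac. Qed.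

Let rhoE0 x : 0 <= rhoE x.
Proof. by apply: margX_ge0 => z; rewrite mulr_ge0. Qed.
Let rhoH0 y : 0 <= rhoH y.
Proof. by apply: margY_ge0 => z; rewrite mulr_ge0. Qed.
Let A0 x : 0 <= A x. Proof. by rewrite mulr_ge0. Qed.
Let B0 x : 0 <= B x. Proof. by rewrite mulr_ge0. Qed.
Let lam0 z : 0 <= lam z. Proof. by rewrite !mulr_ge0. Qed.
Let s0 x : 0 <= s x. Proof. by apply: margX_ge0 => z; rewrite mulr_ge0. Qed.
Let t0 y : 0 <= t y. Proof. by apply: margY_ge0 => z; rewrite mulr_ge0. Qed.
Let tau0 z : 0 <= tau z. Proof. by rewrite !mulr_ge0. Qed.
Let sig0 z : 0 <= sig z. Proof. by rewrite !mulr_ge0. Qed.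

(* Both sides are the integral of e rhoE s u over X. *)
Let lam_tau u : bounded_mfun u ->
  \int[muXY]_z (lam z * u z.1) = \int[muXY]_z (tau z * u z.1).
Proof.
move=> bu.
rewrite (@eq_Rintegral _ _ _ _ _ (fun z => f z * B z.2 * (A z.1 * u z.1))); last first.
  by move=> z _; rewrite /lam; ring.
rewrite [RHS](@eq_Rintegral _ _ _ _ _
    (fun z => g z * \1_F z.2 * (e z.1 * s z.1 * u z.1))); last first.
  by move=> z _; rewrite /tau; ring.
rewrite (@int_margXMr _ _ _ _ _ _ _ (fun z => f z * B z.2)
    (fun x => A x * u x)); [|by bounded_mfun_tac..].
rewrite (@int_margXMr _ _ _ _ _ _ _ (fun z => g z * \1_F z.2)
    (fun x => e x * s x * u x)); [|by bounded_mfun_tac..].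
by apply: eq_Rintegral => x _; rewrite -/(s x) -/(rhoE x) /A; ring.
Qed.

Let lam_sig v : bounded_mfun v ->
  \int[muXY]_z (lam z * v z.2) = \int[muXY]_z (sig z * v z.2).
Proof.
move=> bv.
rewrite (@eq_Rintegral _ _ _ _ _ (fun z => f z * A z.1 * (B z.2 * v z.2))); last first.
  by move=> z _; rewrite /lam; ring.
rewrite [RHS](@eq_Rintegral _ _ _ _ _
    (fun z => g z * \1_G z.1 * (eta z.2 * t z.2 * v z.2))); last first.
  by move=> z _; rewrite /sig; ring.
rewrite (@int_margYMr _ _ _ _ _ _ _ (fun z => f z * A z.1)
    (fun x => B x * v x)); [|by bounded_mfun_tac..].
rewrite (@int_margYMr _ _ _ _ _ _ _ (fun z => g z * \1_G z.1)
    (fun x => eta x * t x * v x)); [|by bounded_mfun_tac..].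
by apply: eq_Rintegral => y _; rewrite -/(t y) -/(rhoH y) /B; ring.
Qed.

Let Lam := \int[muXY]_z lam z.

Let Lam_tau : \int[muXY]_z tau z = Lam.
Proof.
transitivity (\int[muXY]_z (tau z * 1)).
  by apply: eq_Rintegral => z _; rewrite mulr1.
rewrite -(lam_tau (bm_cst _ 1)).
by apply: eq_Rintegral => z _; rewrite mulr1.
Qed.

Let Lam_sig : \int[muXY]_z sig z = Lam.
Proof.
transitivity (\int[muXY]_z (sig z * 1)).
  by apply: eq_Rintegral => z _; rewrite mulr1.
rewrite -(lam_sig (bm_cst _ 1)).
by apply: eq_Rintegral => z _; rewrite mulr1.
Qed.

Let le_threshold (x D y : R) :
  0 <= D -> 0 <= y -> x <= D -> (x != 0 -> c <= y) -> x <= D / c * y.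
Proof.
move=> D0 y0 xD xy; have [->|/xy cy] := eqVneq x 0.
  by rewrite !mulr_ge0// invr_ge0 ltW.
by rewrite (le_trans xD)// mulrAC ler_pdivlMr// ler_wpM2l.
Qed.

(** The marginals of r' are those of a - b, where a is dominated by f, and b by
    the mass of r' times g. The constant K does not depend on r: b becomes small
    against g when the mass of r' does. *)
Lemma reroute : exists K, 0 <= K /\
  forall r, bounded_mfun r -> (forall z, 0 <= r z <= g z) ->
  let r' := fun z => r z * (e z.1 * eta z.2) in
  exists a b : X * Y -> R,
  [/\ bounded_mfun a /\ bounded_mfun b,
      (forall z, 0 <= a z) /\ {ae muXY, forall z, a z <= K * f z},
      (forall z, 0 <= b z <= K * (\int[muXY]_z r' z) * g z) /\
        {ae muXY, forall z, b z != 0 -> c <= f z},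
      forall u, bounded_mfun u -> \int[muXY]_z ((a z - b z - r' z) * u z.1) = 0
    & forall v, bounded_mfun v -> \int[muXY]_z ((a z - b z - r' z) * v z.2) = 0].
Proof.
have rhoE_gt0 : {ae muXY, forall z, E z.1 -> 0 < rhoE z.1}.
  apply: (@ae_fst _ _ _ _ _ _ _ (fun x => E x -> 0 < rhoE x)).
  apply: ae_margX_gt0 => //; apply: filterS2 fg fEF => z fgz + Ez Fz.
  by move=> /(_ Ez Fz) cf; apply/fgz/(lt_le_trans c0).
have rhoH_gt0 : {ae muXY, forall z, H z.2 -> 0 < rhoH z.2}.
  apply: (@ae_snd _ _ _ _ _ _ _ (fun y => H y -> 0 < rhoH y)).
  apply: ae_margY_gt0 => //; apply: filterS2 fg fGH => z fgz + Ez Fz.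
  by move=> /(_ Ez Fz) cf; apply/fgz/(lt_le_trans c0).
clearbody rhoE rhoH s t.
(* If lam is null, so is f on the support of e (x) eta (y), and r' vanishes. *)
have [Lam0|LamN0] := eqVneq Lam 0.
  exists 0; split => // r br rg r'.
  have br' : bounded_mfun r' by rewrite /r'; bounded_mfun_tac.
  have r'0 : {ae muXY, forall z, r' z = 0}.
    have lam00 := bm_int_eq0 blam lam0 Lam0.
    apply: filterS2 (filterI rhoE_gt0 rhoH_gt0) (filterI fg lam00).
    move=> z [rE rH] [fgz lz]; apply/eqP; apply: contrapT => /negP.
    rewrite /r' !mulf_eq0 !negb_or => /and3P[rz ez hz].
    have /fgz fz : 0 < g z.
      have /andP[r0 rgz] := rg z.
      by rewrite (lt_le_trans _ rgz)// lt_neqAle eq_sym rz.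
    have : 0 < lam z.
      by rewrite !mulr_gt0// ?(rE (eE ez)) ?(rH (etaH hz))// lt_neqAle eq_sym ?ez ?hz ?e0 ?eta0.
    by rewrite lz ltxx.
  exists (fun=> 0), (fun=> 0); split.
  - by split; exact: bm_cst.
  - by split => // ; apply: aeW => z; rewrite mul0r.
  - by split => [z|]; [rewrite !mul0r lexx|apply: aeW => z; rewrite eqxx].
  - move=> u bu; rewrite -[RHS](mul0r (fine (muXY setT))) -Rintegral_cst//.
    apply: bm_int_ae => //; [by bounded_mfun_tac..|].
    by apply: filterS r'0 => z ->; rewrite !subr0 mul0r.
  - move=> u bu; rewrite -[RHS](mul0r (fine (muXY setT))) -Rintegral_cst//.
    apply: bm_int_ae => //; [by bounded_mfun_tac..|].
    by apply: filterS r'0 => z ->; rewrite !subr0 mul0r.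
have Lam_gt0 : 0 < Lam by rewrite lt_neqAle eq_sym LamN0 bm_int_ge0.
have LamV0 : 0 <= Lam^-1 by rewrite invr_ge0 ltW.
pose g' z := g z * (e z.1 * eta z.2).
have bg' : bounded_mfun g' by rewrite /g'; bounded_mfun_tac.
pose tY := margY tau; pose sX := margX sig.
have btY : bounded_mfun tY by exact: bm_margY.
have bsX : bounded_mfun sX by exact: bm_margX.
have tY0 y : 0 <= tY y by exact: margY_ge0.
have sX0 y : 0 <= sX y by exact: margX_ge0.
have [B1 [B1_gt0 B1P]] := bm_bound (bm_margX muX muY bg').
have [B2 [B2_gt0 B2P]] := bm_bound btY.
have [B3 [B3_gt0 B3P]] := bm_bound bsX.
have [B4 [B4_gt0 B4P]] := bm_bound (bm_margY muX muY bg').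
have [B5 [B5_gt0 B5P]] : exists M, 0 < M /\ forall z : X * Y, `|A z.1 * B z.2| <= M.
  by apply: bm_bound; bounded_mfun_tac.
have [B6 [B6_gt0 B6P]] : exists M, 0 < M /\ forall x, `|e x * s x| <= M.
  by apply: bm_bound; bounded_mfun_tac.
have [B7 [B7_gt0 B7P]] : exists M, 0 < M /\ forall y, `|eta y * t y| <= M.
  by apply: bm_bound; bounded_mfun_tac.
pose Mg := \int[muXY]_z g' z.
have Mg0 : 0 <= Mg by apply: bm_int_ge0 => z; rewrite !mulr_ge0.
pose K := Lam^-1 * (B1 * B2 / c + B3 * B4 / c + Mg * B5 + B6 + B7).
have K_ge0 : 0 <= K.
  by rewrite /K mulr_ge0// !addr_ge0// ?mulr_ge0 ?invr_ge0// ltW.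
exists K; split => // r br rg r'.
have br' : bounded_mfun r' by rewrite /r'; bounded_mfun_tac.
have r'0 z : 0 <= r' z by rewrite !mulr_ge0//; case/andP: (rg z).
have r'g' z : r' z <= g' z.
  by rewrite ler_wpM2r ?mulr_ge0//; case/andP: (rg z).
pose m := \int[muXY]_z r' z.
have m0 : 0 <= m by exact: bm_int_ge0.
have mMg : m <= Mg by apply: bm_le_int => //; exact: aeW.
pose rX := margX r'; pose rY := margY r'.
have brX : bounded_mfun rX by exact: bm_margX.
have brY : bounded_mfun rY by exact: bm_margY.
have rX0 x : 0 <= rX x by exact: margX_ge0.
have rY0 y : 0 <= rY y by exact: margY_ge0.
have rXB x : rX x <= B1.
  apply: le_trans (le_trans (ler_norm _) (B1P x)).
  by apply: bm_le_int => //; [exact: bm_pair1..|exact: aeW].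
have rYB y : rY y <= B4.
  apply: le_trans (le_trans (ler_norm _) (B4P y)).
  by apply: bm_le_int => //; [exact: bm_pair2..|exact: aeW].
have rXE x : rX x != 0 -> E x.
  move=> rx; apply: eE; apply: contra_neq rx => ex.
  rewrite /rX (_ : r' = fun z => (r z * eta z.2) * e z.1); last first.
    by apply/funext => z; rewrite /r'; ring.
  by rewrite margXMr ?ex ?mulr0//; bounded_mfun_tac.
have rYH y : rY y != 0 -> H y.
  move=> ry; apply: etaH; apply: contra_neq ry => ey.
  rewrite /rY (_ : r' = fun z => (r z * e z.1) * eta z.2); last first.
    by apply/funext => z; rewrite /r'; ring.
  by rewrite margYMr ?ey ?mulr0//; bounded_mfun_tac.
have tYF y : tY y != 0 -> F y.
  move=> ty; apply: contrapT => Fy; move/eqP: ty; apply.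
  rewrite /tY (_ : tau = fun z => (g z * (e z.1 * s z.1)) * \1_F z.2); last first.
    by apply/funext => z; rewrite /tau; ring.
  by rewrite margYMr ?indicE ?memNset ?mulr0//; bounded_mfun_tac.
have sXG x : sX x != 0 -> G x.
  move=> sx; apply: contrapT => Gx; move/eqP: sx; apply.
  rewrite /sX (_ : sig = fun z => (g z * (eta z.2 * t z.2)) * \1_G z.1); last first.
    by apply/funext => z; rewrite /sig; ring.
  by rewrite margXMr ?indicE ?memNset ?mulr0//; bounded_mfun_tac.
have IrX : \int[muX]_x rX x = m by rewrite -int_margX.
have IrY : \int[muY]_x rY x = m by rewrite -int_margY.
have ItY : \int[muY]_x tY x = Lam by rewrite -int_margY.
have IsX : \int[muX]_x sX x = Lam by rewrite -int_margX.
have IrXu u : bounded_mfun u -> \int[muX]_x (rX x * u x) = \int[muXY]_z (r' z * u z.1).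
  by move=> bu; rewrite int_margXMr.
have IrYu u : bounded_mfun u -> \int[muY]_x (rY x * u x) = \int[muXY]_z (r' z * u z.2).
  by move=> bu; rewrite int_margYMr.
have ItYu u : bounded_mfun u -> \int[muY]_x (tY x * u x) = \int[muXY]_z (tau z * u z.2).
  by move=> bu; rewrite int_margYMr.
have IsXu u : bounded_mfun u -> \int[muX]_x (sX x * u x) = \int[muXY]_z (sig z * u z.1).
  by move=> bu; rewrite int_margXMr.
rewrite -/m; clearbody rX rY tY sX Lam m Mg.
pose a z := Lam^-1 * (rX z.1 * tY z.2 + sX z.1 * rY z.2 + m * lam z).
pose b z := Lam^-1 * m * (tau z + sig z).
have ba : bounded_mfun a by rewrite /a; bounded_mfun_tac.
have bb : bounded_mfun b by rewrite /b; bounded_mfun_tac.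
(* Linearity reduces both marginal identities to the integrals computed above. *)
have key w : bounded_mfun w -> \int[muXY]_z ((a z - b z - r' z) * w z) =
    Lam^-1 * (\int[muXY]_z (rX z.1 * tY z.2 * w z)
      + \int[muXY]_z (sX z.1 * rY z.2 * w z)
      + m * \int[muXY]_z (lam z * w z)
      - m * \int[muXY]_z (tau z * w z) - m * \int[muXY]_z (sig z * w z))
    - \int[muXY]_z (r' z * w z).
  move=> bw; rewrite -!bm_intZ; [|by first [exact: measurableT|bounded_mfun_tac]..].
  do 2 (rewrite -bm_intD; [|by first [exact: measurableT|bounded_mfun_tac]..]).
  do 2 (rewrite -bm_intB; [|by first [exact: measurableT|bounded_mfun_tac]..]).
  rewrite -bm_intZ; [|by first [exact: measurableT|bounded_mfun_tac]..].
  rewrite -bm_intB; [|by first [exact: measurableT|bounded_mfun_tac]..].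
  by apply: eq_Rintegral => z _; rewrite /a /b; ring.
exists a, b; split => //.
- split=> [z|].
    by rewrite mulr_ge0// !addr_ge0// mulr_ge0.
  apply: filterS2 fEF fGH => z fE fG.
  rewrite /a /K -[leRHS]mulrA ler_wpM2l// !mulrDl.
  have h1 : rX z.1 * tY z.2 <= B1 * B2 / c * f z.
    apply: le_threshold => //.
    - by rewrite mulr_ge0// ltW.
    - by rewrite ler_pM// (le_trans (ler_norm _) (B2P _)).
    - by rewrite mulf_eq0 negb_or => /andP[/rXE Ex /tYF Fy]; exact: fE.
  have h2 : sX z.1 * rY z.2 <= B3 * B4 / c * f z.
    apply: le_threshold => //.
    - by rewrite mulr_ge0// ltW.
    - by rewrite ler_pM// (le_trans (ler_norm _) (B3P _)).
    - by rewrite mulf_eq0 negb_or => /andP[/sXG Gx /rYH Hy]; exact: fG.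
  have h3 : m * lam z <= Mg * B5 * f z.
    rewrite /lam mulrCA [leRHS]mulrC ler_wpM2l// ler_pM// ?mulr_ge0//.
    by rewrite (le_trans (ler_norm _) (B5P _)).
  rewrite -[leLHS]addr0 -[leLHS]addr0 !lerD//.
  + by rewrite mulr_ge0// ltW.
  + by rewrite mulr_ge0// ltW.
- split=> [z|].
    apply/andP; split; first by rewrite !mulr_ge0// addr_ge0.
    rewrite /b /K -!mulrA ler_wpM2l// [leRHS]mulrCA ler_wpM2l//.
    rewrite /tau /sig.
    have h1 : g z * \1_F z.2 * (e z.1 * s z.1) <= g z * B6.
      rewrite ler_pM// ?mulr_ge0//.
        by rewrite ler_piMr// indicE lern1 leq_b1.
      by rewrite (le_trans (ler_norm _) (B6P _)).
    have h2 : g z * \1_G z.1 * (eta z.2 * t z.2) <= g z * B7.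
      rewrite ler_pM// ?mulr_ge0//.
        by rewrite ler_piMr// indicE lern1 leq_b1.
      by rewrite (le_trans (ler_norm _) (B7P _)).
    rewrite (le_trans (lerD h1 h2))// -mulrDr mulrC ler_wpM2r// -[leRHS]addrA lerDr.
    by rewrite !addr_ge0// ?mulr_ge0 ?invr_ge0// ltW.
  apply: filterS2 fEF fGH => z fE fG.
  rewrite /b mulf_eq0 negb_or => /andP[_].
  have [tz|tz] := eqVneq (tau z) 0.
    rewrite tz add0r /sig !mulf_eq0 !negb_or => /andP[/andP[_ Gz] /andP[hz _]].
    by apply: fG; [exact: (indic_neq0 Gz)|exact: etaH].
  move: tz; rewrite /tau !mulf_eq0 !negb_or => /andP[/andP[_ Fz] /andP[ez _]] _.
  by apply: fE; [exact: eE|exact: (indic_neq0 Fz)].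
- move=> u bu; rewrite key; last by bounded_mfun_tac.
  rewrite (@eq_Rintegral _ _ _ _ _ (fun z => (rX z.1 * u z.1) * tY z.2)); last first.
    by move=> z _; ring.
  rewrite (@int_prod _ _ _ _ _ muX muY (fun x => rX x * u x) tY); [|by bounded_mfun_tac..].
  rewrite (@eq_Rintegral _ _ _ _ _ (fun z => (sX z.1 * u z.1) * rY z.2)
      (fun z => sX z.1 * rY z.2 * u z.1)); last first.
    by move=> z _; ring.
  rewrite (@int_prod _ _ _ _ _ muX muY (fun x => sX x * u x) rY); [|by bounded_mfun_tac..].
  rewrite IrXu// IsXu// ItY IrY lam_tau//.
  by field.
- move=> v bv; rewrite key; last by bounded_mfun_tac.
  rewrite (@eq_Rintegral _ _ _ _ _ (fun z => rX z.1 * (tY z.2 * v z.2))); last first.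
    by move=> z _; ring.
  rewrite (@int_prod _ _ _ _ _ muX muY rX (fun y => tY y * v y)); [|by bounded_mfun_tac..].
  rewrite (@eq_Rintegral _ _ _ _ _ (fun z => sX z.1 * (rY z.2 * v z.2))
      (fun z => sX z.1 * rY z.2 * v z.2)); last first.
    by move=> z _; ring.
  rewrite (@int_prod _ _ _ _ _ muX muY sX (fun y => rY y * v y)); [|by bounded_mfun_tac..].
  rewrite IrYu// ItYu// IrX IsX lam_sig//.
  by field.
Qed.

End Reroute.

(** * A competitor with bounded ratio *)

(** Overlapping pieces can be handled one at a time after weighting them; the
    weights are indicators of the pieces made disjoint. *)
Lemma partition_of_unity d (T : measurableType d) (R : realType) m
    (E : 'I_m -> set T) : (forall i, measurable (E i)) ->
  exists e : 'I_m -> T -> R,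
  [/\ forall i, bounded_mfun (e i), forall i x, 0 <= e i x <= 1,
      forall i x, e i x != 0 -> E i x
    & forall x, (\bigcup_i E i) x -> \sum_i e i x = 1].
Proof.
elim: m E => [|m ih] E mE.
  by exists (fun=> fun=> 0); split=> [[]|[]|[]|x [[]]].
have [e [be e01 eE e1]] := ih (fun i => E (lift ord0 i)) (fun i => mE _).
exists (fun i x => if unlift ord0 i is Some j then (1 - \1_(E ord0) x) * e j x
                   else \1_(E ord0) x); split.
- by move=> i; case: unliftP => [j _|_]; bounded_mfun_tac.
- move=> i x; have i0 : 0 <= \1_(E ord0) x :> R by rewrite indicE.
  have i1 : \1_(E ord0) x <= 1 :> R by rewrite indicE lern1 leq_b1.
  case: unliftP => [j _|_]; last by rewrite i0.
  have /andP[ej0 ej1] := e01 j x.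
  by rewrite mulr_ge0 ?subr_ge0// mulr_ile1 ?subr_ge0 ?gerBl.
- move=> i x; case: unliftP => [j ->|->].
    by rewrite mulf_eq0 negb_or => /andP[_ /eE].
  exact: indic_neq0.
- move=> x [i _ Eix]; rewrite big_ord_recl unlift_none.
  under eq_bigr do rewrite liftK.
  rewrite -mulr_sumr indicE; case: (boolP (x \in E ord0)) => xE0.
    by rewrite subrr mul0r addr0.
  rewrite subr0 mul1r add0r e1//.
  move: Eix; case: (unliftP ord0 i) => [j ->|->] Eix; first by exists j.
  by rewrite mem_set in xE0.
Qed.

Lemma ae_forall_fin d (T : measurableType d) (R : realType)
    (mu : {measure set T -> \bar R}) (I : finType) (P : I -> T -> Prop) :
  (forall i, {ae mu, forall x, P i x}) -> {ae mu, forall x, forall i, P i x}.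
Proof.
move=> aeP; have : {ae mu, forall x, forall i, i \in enum I -> P i x}.
  elim: (enum I) => [|j s ih]; first by apply: aeW => x i; rewrite in_nil.
  apply: filterS2 (aeP j) ih => x Pj Ps i; rewrite in_cons => /predU1P[->//|].
  exact: Ps.
by apply: filterS => x Px i; apply: Px; rewrite mem_enum.
Qed.

Section Competitor.
Context d1 d2 (X : measurableType d1) (Y : measurableType d2) (R : realType).
Variables (muX : {finite_measure set X -> \bar R})
          (muY : {finite_measure set Y -> \bar R}).
Local Notation muXY := (prod_measure muX muY).

Variables (f g : X * Y -> R) (c : R) (m n : nat).
Variables (E : 'I_m -> set X) (F : 'I_m -> set Y).
Variables (G : 'I_n -> set X) (H : 'I_n -> set Y).
Hypotheses (bf : bounded_mfun f) (bg : bounded_mfun g) (f0 : forall z, 0 <= f z)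
  (g0 : forall z, 0 <= g z).
Hypothesis fg : {ae muXY, forall z, (0 < f z) <-> (0 < g z)}.
Hypothesis c0 : 0 < c.
Hypotheses (mE : forall i, measurable (E i)) (mF : forall i, measurable (F i)).
Hypotheses (mG : forall j, measurable (G j)) (mH : forall j, measurable (H j)).
Hypotheses (F0 : forall i, (0 < muY (F i))%E) (G0 : forall j, (0 < muX (G j))%E).
Hypothesis fEF : forall i, {ae muXY, forall z, E i z.1 -> F i z.2 -> c <= f z}.
Hypothesis fGH : forall j, {ae muXY, forall z, G j z.1 -> H j z.2 -> c <= f z}.
Hypothesis cover : {ae muXY, forall z, 0 < f z ->
  (\bigcup_i E i) z.1 /\ (\bigcup_j H j) z.2}.

(* Dominated by g, and eventually zero wherever f > 0. *)
Let excess_cvg0 :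
  \int[muXY]_z Num.max (g z - k%:R * f z) 0 @[k --> \oo] --> 0.
Proof.
pose r k z := Num.max (g z - k%:R * f z) 0.
have br k : bounded_mfun (r k) by rewrite /r; bounded_mfun_tac.
have [|||||_ _] := @dominated_convergence _ _ _ muXY setT measurableT
  (fun k => EFin \o r k) (cst 0%E) (EFin \o g) => //.
- by move=> k; apply/measurable_EFinP; case: (br k).
- apply: filterS fg => z fgz _.
  have [fz|fz] := ltP 0 (f z).
    apply: cvg_near_cst; near=> k => /=.
    rewrite /r max_r// subr_le0 -ler_pdivrMr//.
    by near: k; exact: nbhs_infty_ger.
  have fz0 : f z = 0 by apply/eqP; rewrite eq_le fz f0.
  have gz0 : g z = 0.
    by apply/eqP; rewrite eq_le g0 leNgt andbT; apply/negP => /fgz; rewrite ltNge fz.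
  apply: cvg_near_cst; apply: nearW => k /=.
  by rewrite /r fz0 gz0 mulr0 subr0 maxxx.
- exact: bm_integrable.
- apply: aeW => z k _ /=; rewrite lee_fin ger0_norm ?le_max ?lexx ?orbT//.
  by rewrite ge_max g0 gerBl mulr_ge0.
rewrite integral0 => /fine_cvgP[_].
by apply: cvg_trans; apply: near_eq_cvg; apply: nearW => k.
Unshelve. all: by end_near. Qed.

(** For k large, replace the excess r = max (g - k f, 0) in every cell
    E_i x H_j by its rerouted version. What remains of g is min (g, k f), and
    the mass taken away to compensate is at most half of it: on the rectangles
    f >= c, so that min (g, k f) = g there as soon as k c bounds g. *)
Lemma competitor : exists (q : X * Y -> R) (C : R),
  [/\ bounded_mfun q, 0 <= C /\ (forall z, 0 <= q z <= C * f z),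
      {ae muXY, forall z, 0 < f z -> 0 < q z},
      forall u, bounded_mfun u -> \int[muXY]_z (q z * u z.1) = \int[muXY]_z (g z * u z.1)
    & forall v, bounded_mfun v -> \int[muXY]_z (q z * v z.2) = \int[muXY]_z (g z * v z.2)].
Proof.
have [e [be e01 eE e1]] := partition_of_unity R mE.
have [h [bh h01 hH h1]] := partition_of_unity R mH.
have e0 i x : 0 <= e i x by case/andP: (e01 i x).
have h0 j y : 0 <= h j y by case/andP: (h01 j y).
have /choice[K KP] := fun ij : 'I_m * 'I_n =>
  reroute bf bg f0 g0 fg c0 (mF ij.1) (mG ij.2) (F0 ij.1) (G0 ij.2) (fEF ij.1)
    (fGH ij.2) (be ij.1) (bh ij.2) (e0 ij.1) (h0 ij.2) (@eE ij.1) (@hH ij.2).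
have K0 ij : 0 <= K ij by case: (KP ij).
pose Ks := \sum_ij K ij.
have Ks0 : 0 <= Ks by apply: sumr_ge0.
have [M [M_gt0 gM]] := bm_bound bg.
(* First bound: k f >= g wherever f >= c. Second bound: the mass removed on the
   rectangles is at most g / 2. *)
have [k kMc kKs] : exists2 k : nat, M / c <= k%:R &
    Ks * (\int[muXY]_z Num.max (g z - k%:R * f z) 0) <= 2^-1.
  have del0 : 0 < (2 * (Ks + 1))^-1 :> R.
    by rewrite invr_gt0 mulr_gt0// ltr_wpDl.
  have /cvgrPdist_le/(_ _ del0) := excess_cvg0.
  move=> /(filterI (nbhs_infty_ger (M / c)))/filter_ex[k [kMc]].
  rewrite sub0r normrN => kr; exists k => //.
  have := le_trans (ler_norm _) kr; set r := \int[_]_z _ => rle.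
  have r0 : 0 <= r by apply: bm_int_ge0 => z; rewrite le_max lexx orbT.
  rewrite (le_trans (ler_wpM2l Ks0 rle))// invfM mulrCA ler_piMr//.
  by rewrite ler_pdivrMr ?mul1r ?lerDl// ltr_wpDl.
set C : R := k%:R in kMc kKs.
pose r z := Num.max (g z - C * f z) 0.
have br : bounded_mfun r by rewrite /r; bounded_mfun_tac.
have r0 z : 0 <= r z by rewrite le_max lexx orbT.
have rg z : 0 <= r z <= g z.
  by rewrite r0 ge_max g0 gerBl mulr_ge0.
have C0 : 0 <= C by [].
pose r' ij z := r z * (e ij.1 z.1 * h ij.2 z.2).
have br' ij : bounded_mfun (r' ij) by rewrite /r'; bounded_mfun_tac.
have r'0 ij z : 0 <= r' ij z by rewrite !mulr_ge0.
have /choice[a /choice[b abP]] : forall ij, exists a b, _ := fun ij => (KP ij).2 r br rg.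
have ba ij : bounded_mfun (a ij) by case: (abP ij) => -[].
have bb ij : bounded_mfun (b ij) by case: (abP ij) => -[].
have a0 ij z : 0 <= a ij z by case: (abP ij) => _ [].
have b0 ij z : 0 <= b ij z by case: (abP ij) => _ _ [/(_ z)/andP[]].
pose q0 z := g z + \sum_ij (a ij z - b ij z - r' ij z).
have bq0 : bounded_mfun q0 by rewrite /q0; bounded_mfun_tac.
have q0w w : bounded_mfun w -> (forall ij, \int[muXY]_z ((a ij z - b ij z - r' ij z) * w z) = 0) ->
    \int[muXY]_z (q0 z * w z) = \int[muXY]_z (g z * w z).
  move=> bw wP; under eq_Rintegral do rewrite /q0 mulrDl mulr_suml.
  rewrite bm_intD//; [|by bounded_mfun_tac..].
  rewrite bm_int_sum//; last by move=> ij; bounded_mfun_tac.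
  by rewrite big1 ?addr0.
have q0E z : q0 z = g z + \sum_ij a ij z - \sum_ij b ij z - \sum_ij r' ij z.
  by rewrite /q0 !sumrB; ring.
have sum_a : {ae muXY, forall z, \sum_ij a ij z <= Ks * f z}.
  have : {ae muXY, forall z, forall ij, a ij z <= K ij * f z}.
    by apply/ae_forall_fin => ij; case: (abP ij) => _ [].
  by apply: filterS => z az; rewrite /Ks mulr_suml ler_sum.
have sum_b : {ae muXY, forall z, \sum_ij b ij z <= 2^-1 * Num.min (g z) (C * f z)}.
  have : {ae muXY, forall z, forall ij, b ij z != 0 -> c <= f z}.
    by apply/ae_forall_fin => ij; case: (abP ij) => _ _ [].
  apply: filterS => z bz.
  have min0 : 0 <= Num.min (g z) (C * f z) by rewrite le_min g0 mulr_ge0.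
  have [cf|fc] := leP c (f z); last first.
    rewrite big1 ?mulr_ge0// => ij _; apply/eqP; apply: contraTT fc => /bz.
    by rewrite -leNgt.
  have -> : Num.min (g z) (C * f z) = g z.
    apply/min_idPl; rewrite (le_trans (le_trans (ler_norm _) (gM z)))//.
    by rewrite (le_trans _ (ler_wpM2l C0 cf))// -ler_pdivrMr.
  apply: (@le_trans _ _ (\sum_ij K ij * (\int[muXY]_z r z) * g z)).
    apply: ler_sum => ij _; case: (abP ij) => _ _ [/(_ z)/andP[_ bK] _] _ _.
    rewrite (le_trans bK)// ler_wpM2r// ler_wpM2l//.
    apply: bm_le_int => //; [exact: (br' ij)|].
    apply: aeW => t; rewrite /r' ler_piMr// mulr_ile1//.
      by case/andP: (e01 ij.1 t.1).
    by case/andP: (h01 ij.2 t.2).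
  by rewrite -mulr_suml -mulr_suml ler_wpM2r.
have sum_r' : {ae muXY, forall z, 0 < f z -> \sum_ij r' ij z = r z}.
  apply: filterS cover => z + fz => /(_ fz)[Ez Hz].
  rewrite /r' -mulr_sumr -(pair_bigA _ (fun i j => e i z.1 * h j z.2))/=.
  under eq_bigr do rewrite -mulr_sumr h1// mulr1.
  by rewrite e1// mulr1.
have minE z : Num.min (g z) (C * f z) = g z - r z.
  rewrite /r; case: (leP (g z) (C * f z)) => gz.
    by rewrite max_r ?subr0// subr_le0.
  by rewrite max_l ?subr_ge0 ?ltW//; ring.
pose C' := C + Ks.
have C'0 : 0 <= C' by rewrite addr_ge0.
have q0P : {ae muXY, forall z, 2^-1 * Num.min (g z) (C * f z) <= q0 z <= C' * f z}.
  apply: filterS2 (filterI sum_a sum_b) (filterI sum_r' fg) => z [az bz] [rz fgz].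
  have bs0 : 0 <= \sum_ij b ij z by apply: sumr_ge0.
  have as0 : 0 <= \sum_ij a ij z by apply: sumr_ge0.
  rewrite q0E; have [fz|fz] := ltP 0 (f z).
    rewrite rz//; have := minE z.
    have Cf : Num.min (g z) (C * f z) <= C * f z by rewrite ge_min lexx orbT.
    have m0 : 0 <= Num.min (g z) (C * f z) by rewrite le_min g0 mulr_ge0.
    rewrite /C' mulrDl; move: (Num.min _ _) bz Cf m0 => mn bz Cf m0 mnE.
    by apply/andP; split; lra.
  have fz0 : f z = 0 by apply/eqP; rewrite eq_le fz f0.
  have gz0 : g z = 0.
    by apply/eqP; rewrite eq_le g0 leNgt andbT; apply/negP => /fgz; rewrite ltNge fz.
  have rz0 : r z = 0 by rewrite /r fz0 gz0 mulr0 subr0 maxxx.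
  have -> : \sum_ij r' ij z = 0 by rewrite big1// => ij _; rewrite /r' rz0 mul0r.
  move: az bz; rewrite fz0 gz0 !mulr0 minxx => az bz.
  by apply/andP; split; lra.
(* Truncation turns the almost sure bounds on q0 into sure ones. *)
pose q z := Num.max 0 (Num.min (q0 z) (C' * f z)).
have qq0 : {ae muXY, forall z, q0 z = q z}.
  apply: filterS q0P => z /andP[q0l q0u]; rewrite /q (min_idPl q0u) max_r//.
  by rewrite (le_trans _ q0l)// mulr_ge0// le_min g0 mulr_ge0.
have bq : bounded_mfun q by rewrite /q; bounded_mfun_tac.
exists q, C'; split => //.
- by split => // z; rewrite /q le_max lexx/= ge_max mulr_ge0//= ge_min lexx orbT.
- have C_gt0 : 0 < C by rewrite (lt_le_trans _ kMc)// divr_gt0.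
  apply: filterS2 (filterI q0P qq0) fg => z [/andP[q0l _] <-] fgz fz.
  by rewrite (lt_le_trans _ q0l)// mulr_gt0 ?invr_gt0// lt_min mulr_gt0// andbT; exact/fgz.
- move=> u bu; rewrite -q0w; [|by bounded_mfun_tac|by move=> ij; case: (abP ij) => _ _ _ /(_ u bu)].
  by apply: bm_int_ae => //; [by bounded_mfun_tac..|apply: filterS qq0 => z ->].
- move=> v bv.
  rewrite -q0w; [|by bounded_mfun_tac|by move=> ij; case: (abP ij) => _ _ _ _ /(_ v bv)].
  by apply: bm_int_ae => //; [by bounded_mfun_tac..|apply: filterS qq0 => z ->].
Qed.

End Competitor.

(** * Minimizing the entropy functional *)

Lemma le_geometric (R : realType) (x y c : R) :
  (forall n : nat, x <= y + 2^-1 ^+ n * c) -> x <= y.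
Proof.
move=> xy; have : y + 2^-1 ^+ n * c @[n --> \oo] --> y + 0 * c.
  apply: cvgD; first exact: cvg_cst.
  apply: cvgMl; apply: cvg_expr.
  by rewrite ger0_norm ?invr_ge0// invf_lt1// ltr1n.
rewrite mul0r addr0 => yc; apply: (ler_cvg_to (cvg_cst x) yc).
exact: nearW.
Qed.

(** The convex function t |-> (e^t - 1) P - t Q is nonnegative and vanishes at 0,
    so its derivative P - Q at 0 vanishes. *)
Lemma expR_tangent_eq (R : realType) (P Q : R) : 0 <= P -> 0 <= Q ->
  (forall t, t * Q <= (expR t - 1) * P) -> P = Q.
Proof.
rewrite le_eqVlt => /predU1P[<-|P0]; rewrite le_eqVlt => /predU1P[<-|Q0] tPQ //.
- by have := tPQ 1; rewrite mul1r mulr0 leNgt Q0.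
- have := tPQ (-1); rewrite mulr0 pmulr_lge0// subr_ge0 leNgt.
  by rewrite expR_lt1 oppr_lt0 ltr01.
have := tPQ (ln (Q / P)); rewrite lnK ?posrE ?divr_gt0//.
rewrite mulrBl mulfVK ?gt_eqF// mul1r => h.
apply/eqP; apply: contraT => PQ.
have nz : P / Q - 1 != 0.
  by rewrite subr_eq0; apply: contra PQ => /eqP/divr1_eq ->.
have := expR_gt1Dx nz; rewrite addrCA subrr addr0 => h2.
have : ln (P / Q) < P / Q - 1.
  by rewrite -[ltRHS]expRK ltr_ln ?posrE ?expR_gt0 ?divr_gt0.
rewrite -[P / Q]invf_div lnV ?posrE ?divr_gt0// => h3.
have := h3; rewrite -(ltr_pM2r Q0) mulrBl mulNr invf_div mulfVK ?gt_eqF// => h4.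
by have := lt_le_trans h4 (le_refl _); lra.
Qed.

Section Fatou.
Context d (T : measurableType d) (R : realType).
Variable mu : {measure set T -> \bar R}.

Lemma fatou_bound (D : set T) (h_ : nat -> T -> \bar R) (h : T -> \bar R) (B : \bar R) :
  measurable D -> (forall k, measurable_fun D (h_ k)) ->
  measurable_fun D h ->
  (forall k x, D x -> 0 <= h_ k x)%E -> (forall x, D x -> 0 <= h x)%E ->
  {ae mu, forall x, D x -> h_ ^~ x @ \oo --> h x} ->
  (forall k, \int[mu]_(x in D) h_ k x <= B)%E ->
  (\int[mu]_(x in D) h x <= B)%E.
Proof.
move=> mD mh_ mh h_0 h0 hh hB.
have ml : measurable_fun D (fun x => limn_einf (h_ ^~ x)).
  rewrite (_ : (fun x => _) = (fun x => - limn_esup (fun k => - h_ k x))%E)//.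
  apply: measurableT_comp => //; apply: measurable_fun_limn_esup => k.
  exact: measurableT_comp.
rewrite (@ge0_ae_eq_integral _ _ _ mu D h (fun x => limn_einf (h_ ^~ x)))//; last first.
- by apply: filterS hh => x hx Dx; rewrite (cvg_limn_einf_sup (hx Dx)).
- move=> x Dx; rewrite limn_einf_lim; apply: lime_ge; first exact: is_cvg_einfs.
  apply: nearW => k; apply: le_ereal_inf_tmp => _ [j /= _ <-]; exact: h_0.
apply: le_trans (fatou mu mD mh_ h_0) _.
rewrite limn_einf_lim; apply: lime_le; first exact: is_cvg_einfs.
apply: nearW => k; apply: le_trans (hB k).
by apply: ereal_inf_lbound; exists k => /=.
Qed.

End Fatou.
(** W is modelled on the bounded functions u (x) + v (y): it is stable under
    midpoints, and under adding t 1_A for the sets A on which the integrals of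
    f e^w and q are to agree. *)
Section EntropyProjection.
Context d (T : measurableType d) (R : realType).
Variable mu : {finite_measure set T -> \bar R}.
Variables (f q : T -> R) (C : R) (W : set (T -> R)).
Hypotheses (bf : bounded_mfun f) (bq : bounded_mfun q) (C0 : 0 <= C).
Hypotheses (f0 : forall x, 0 <= f x) (qCf : forall x, 0 <= q x <= C * f x).
Hypothesis q_gt0 : {ae mu, forall x, 0 < f x -> 0 < q x}.
Hypotheses (W_neq0 : W !=set0) (bW : forall w, W w -> bounded_mfun w).
Hypothesis W_mid : forall v w, W v -> W w -> W (fun x => (v x + w x) / 2).

Let q0 x : 0 <= q x. Proof. by case/andP: (qCf x). Qed.

Let J w := \int[mu]_x (f x * expR (w x) - q x * w x).
Let K := \int[mu]_x (C ^+ 2 * f x).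

(* Where w >= 0, f e^w >= f w^2 / 4 absorbs q w <= C f w up to C^2 f. *)
Let J_coercive w : W w -> \int[mu]_x (q x * Num.max (- w x) 0) <= J w + K.
Proof.
move=> /bW bw; rewrite /J /K -bm_intD; [|exact: measurableT|by bounded_mfun_tac..].
apply: bm_le_int; [exact: measurableT|by bounded_mfun_tac..|]; apply: aeW => x.
have fx := f0 x; have /andP[qx qC] := qCf x.
have [wx|wx] := leP 0 (w x); last first.
  rewrite max_l ?oppr_ge0 ?(ltW wx)// mulrN -subr_ge0 opprK addrAC subrK.
  by rewrite addr_ge0 ?mulr_ge0 ?expR_ge0 ?exprn_ge0.
rewrite max_r ?oppr_le0// mulr0.
have e2 : expR (w x) = expR (w x / 2) ^+ 2.
  by rewrite expr2 -expRD; congr expR; field.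
have e1 : (w x / 2) ^+ 2 <= expR (w x).
  rewrite e2 ler_sqr ?nnegrE ?expR_ge0 ?divr_ge0//.
  by apply: le_trans (expR_ge1Dx _); rewrite lerDr.
have h1 : f x * (w x / 2) ^+ 2 <= f x * expR (w x) by rewrite ler_wpM2l.
have h2 : q x * w x <= C * f x * w x by rewrite ler_wpM2r.
have h3 : 0 <= f x * (w x / 2 - C) ^+ 2 by rewrite mulr_ge0 ?sqr_ge0.
have h4 : f x * (w x / 2 - C) ^+ 2 = f x * (w x / 2) ^+ 2 - C * f x * w x + C ^+ 2 * f x.
  by field.
move: h1 h2 h3; rewrite h4 => h1 h2 h3.
apply: le_trans h3 _; rewrite -subr_ge0.
have -> : f x * expR (w x) - q x * w x + C ^+ 2 * f x -
    (f x * (w x / 2) ^+ 2 - C * f x * w x + C ^+ 2 * f x) =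
    (f x * expR (w x) - f x * (w x / 2) ^+ 2) + (C * f x * w x - q x * w x).
  by ring.
by rewrite addr_ge0 ?subr_ge0.
Qed.

Let m := inf (J @` W).

Let J_has_inf : has_inf (J @` W).
Proof.
split; first by have [w Ww] := W_neq0; exists (J w), w.
exists (- K) => _ [w Ww <-]; rewrite -subr_ge0 opprK.
apply: le_trans (J_coercive Ww); apply: bm_int_ge0 => x.
by rewrite mulr_ge0// le_max lexx orbT.
Qed.

Let m_le w : W w -> m <= J w.
Proof. by move=> Ww; apply: ge_inf; [case: J_has_inf|exists w]. Qed.

Let del (n : nat) : R := 2^-1 ^+ n.
Let del_gt0 n : 0 < del n. Proof. by rewrite exprn_gt0 ?invr_gt0. Qed.
Let del_le1 n : del n <= 1.
Proof. by rewrite exprn_ile1 ?invr_ge0// invf_le1// ler1n. Qed.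

Let minimizing : exists w_ : nat -> T -> R,
  forall n, W (w_ n) /\ J (w_ n) <= m + del n ^+ 2.
Proof.
suff /choice[w_ w_P] : forall n, exists w, W w /\ J w <= m + del n ^+ 2 by exists w_.
move=> n; have d2 : 0 < del n ^+ 2 by rewrite exprn_gt0.
have [_ [w Ww <-] Jw] := inf_adherent d2 J_has_inf.
by exists w; split => //; exact: ltW.
Qed.

Section WithSequence.
Variable w_ : nat -> T -> R.
Hypothesis w_P : forall n, W (w_ n) /\ J (w_ n) <= m + del n ^+ 2.
Let bw n : bounded_mfun (w_ n). Proof. by apply: bW; case: (w_P n). Qed.

Let g n x := expR (w_ n x / 2).
Let bg n : bounded_mfun (g n). Proof. by rewrite /g; bounded_mfun_tac. Qed.
Let g_ge0 n x : 0 <= g n x. Proof. exact: expR_ge0. Qed.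
Let g2 n x : g n x ^+ 2 = expR (w_ n x).
Proof. by rewrite /g expr2 -expRD; congr expR; field. Qed.

(* The terms in q are linear in w and cancel; what is left is the polarization
   of exp w = (exp (w / 2))^2. *)
Let parallelogram n k :
  \int[mu]_x (f x * (g n x - g k x) ^+ 2) <= del n ^+ 2 + del k ^+ 2.
Proof.
pose w x := (w_ n x + w_ k x) / 2.
have [Wn Jn] := w_P n; have [Wk Jk] := w_P k.
have Ww : W w by exact: W_mid.
have bw' : bounded_mfun w by exact: bW.
have -> : \int[mu]_x (f x * (g n x - g k x) ^+ 2) = J (w_ n) + J (w_ k) - 2 * J w.
  rewrite /J -bm_intZ; [|by first [exact: measurableT|bounded_mfun_tac]..].
  rewrite -bm_intD; [|by first [exact: measurableT|bounded_mfun_tac]..].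
  rewrite -bm_intB; [|by first [exact: measurableT|bounded_mfun_tac]..].
  apply: eq_Rintegral => x _; rewrite -!g2.
  have -> : expR (w x) = g n x * g k x.
    by rewrite /g -expRD; congr expR; rewrite /w; field.
  by rewrite /w; field.
by have := m_le Ww; lra.
Qed.

(* From L^2 to L^1 by 2 |s| <= s^2 / d + d, with d = 2^-n, the scale at which
   both terms are summable. *)
Let increments n :
  \int[mu]_x (f x * `|g n.+1 x - g n x|) <=
  (2 + \int[mu]_x f x) / (2 ^ n.+1)%:R.
Proof.
have dn := del_gt0 n.
have -> : (2 + \int[mu]_x f x) / (2 ^ n.+1)%:R =
    (2 * del n)^-1 * (2 * del n ^+ 2) + (del n / 2) * \int[mu]_x f x.
  by rewrite natrX exprS /del exprVn; field; rewrite expf_neq0.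
apply: (@le_trans _ _ ((2 * del n)^-1 * \int[mu]_x (f x * (g n.+1 x - g n x) ^+ 2) +
   (del n / 2) * \int[mu]_x f x)).
  rewrite -bm_intZ; [|by first [exact: measurableT|bounded_mfun_tac]..].
  rewrite -bm_intZ; [|by first [exact: measurableT|bounded_mfun_tac]..].
  rewrite -bm_intD; [|by first [exact: measurableT|bounded_mfun_tac]..].
  apply: bm_le_int; [exact: measurableT|by bounded_mfun_tac..|]; apply: aeW => x.
  rewrite -[_ ^+ 2]real_normK ?num_real//; set t := `|_|.
  have -> : (2 * del n)^-1 * (f x * t ^+ 2) + del n / 2 * f x =
     f x * t + f x * ((2 * del n)^-1 * (t - del n) ^+ 2).
    by field; rewrite gt_eqF.
  rewrite lerDl; apply: mulr_ge0 => //; apply: mulr_ge0; last exact: sqr_ge0.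
  by rewrite invr_ge0 mulr_ge0// ltW.
rewrite lerD2r ler_pM2l ?invr_gt0 ?mulr_gt0//.
apply: le_trans (parallelogram _ _) _.
have : del n.+1 ^+ 2 <= del n ^+ 2.
  rewrite ler_sqr ?nnegrE ?(ltW (del_gt0 _))//.
  by rewrite /del exprS ler_piMl ?exprn_ge0 ?invr_ge0// invf_le1// ler1n.
lra.
Qed.

(* The sum over n of the increments weighted by f is integrable, hence finite
   almost everywhere. *)
Let cvg_g : {ae mu, forall x, 0 < f x -> cvgn (g ^~ x)}.
Proof.
pose h n x : \bar R := (f x * `|g n.+1 x - g n x|)%:E.
have mh n : measurable_fun setT (h n).
  by apply/measurable_EFinP; apply: bm_meas; bounded_mfun_tac.
have h0 n x : (0 <= h n x)%E by rewrite lee_fin mulr_ge0.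
have B0 : 0 <= 2 + \int[mu]_x f x by rewrite addr_ge0// bm_int_ge0.
have hfin : (\int[mu]_x (\sum_(n <oo) h n x) < +oo)%E.
  rewrite integral_nneseries//.
  apply: le_lt_trans (ltry (2 + \int[mu]_x f x)).
  apply: le_trans (epsilon_trick0 xpredT B0).
  apply: lee_nneseries => [n _ _|n _]; first exact: integral_ge0.
  by rewrite bm_EFin ?lee_fin//; bounded_mfun_tac.
have hint : mu.-integrable setT (fun x => \sum_(n <oo) h n x)%E.
  apply/integrableP; split.
    by apply: ge0_emeasurable_sum => // n x _ _; exact: h0.
  under eq_integral do (rewrite gee0_abs; last exact: nneseries_ge0).
  exact: hfin.
apply: filterS (integrable_ae measurableT hint) => x /(_ I) xfin fx.
have cs : cvgn [normed series (telescope (g ^~ x))].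
  apply: nondecreasing_is_cvgn.
    by apply: nondecreasing_series => n _ _ /=; exact: normr_ge0.
  exists ((f x)^-1 * fine (\sum_(n <oo) h n x)%E) => _ [n _ <-] /=.
  rewrite -ler_pdivrMl ?invr_gt0// invrK -lee_fin fineK//.
  apply: le_trans (nneseries_lim_ge n _); last by by move=> *; exact: h0.
  rewrite /series/= mulr_sumr -sumEFin.
  by apply: lee_sum => i _; rewrite /h /telescope.
have := normed_cvg cs; rewrite telescopeK => cg.
have -> : g ^~ x = (fun n => (g n x - g 0%N x) + g 0%N x).
  by apply/funext => n; rewrite subrK.
by apply: is_cvgD => //; exact: is_cvg_cst.
Qed.

(* An upper limit is measurable with no assumption of convergence. *)
Let G x := Num.max 0 (fine (limn_esup (fun n => (g n x)%:E))).

Let mG : measurable_fun setT G.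
Proof.
apply: measurable_maxr => //; apply: measurableT_comp => //.
apply: measurable_fun_limn_esup => n.
by apply/measurable_EFinP; case: (bg n).
Qed.

Let G_ge0 x : 0 <= G x. Proof. by rewrite le_max lexx. Qed.

Let G_lim : {ae mu, forall x, 0 < f x -> g ^~ x @ \oo --> G x}.
Proof.
apply: filterS cvg_g => x /[apply] cg.
have cgE : (g n x)%:E @[n --> \oo] --> (limn (g ^~ x))%:E.
  by apply: cvg_EFin; [exact: nearW|exact: cg].
rewrite /G (cvg_limn_einf_sup cgE)/= max_r//.
by apply: limr_ge => //; apply: nearW => n; exact: g_ge0.
Qed.

(* Where G = 0 < q, the function q max (- w_n, 0) tends to infinity, while its
   integral is bounded by coercivity: Fatou makes this set null. *)
Let G_gt0 : {ae mu, forall x, 0 < f x -> 0 < G x}.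
Proof.
pose N := [set x | 0 < q x] `&` [set x | G x = 0].
have mN : measurable N.
  apply: measurableI.
    have -> : [set x | 0 < q x] = q @^-1` `]0, +oo[%classic.
      by apply/seteqP; split => x /=; rewrite in_itv/= andbT.
    by rewrite -[X in measurable X]setTI; apply: (bm_meas bq).
  have -> : [set x | G x = 0] = G @^-1` [set 0] by [].
  by rewrite -[X in measurable X]setTI; apply: mG.
pose h k x := (q x * Num.max (- w_ k x) 0)%:E.
have bh k : bounded_mfun (fun x => q x * Num.max (- w_ k x) 0) by bounded_mfun_tac.
have h0 k x : (0 <= h k x)%E by rewrite lee_fin mulr_ge0// le_max lexx orbT.
have mh k : measurable_fun setT (h k) by apply/measurable_EFinP; case: (bh k).
have : (\int[mu]_(x in N) cst +oo x <= (m + 1 + K)%:E)%E.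
  apply: (@fatou_bound _ _ _ mu N h) => //.
  - by move=> k; exact: measurable_funTS.
  - by move=> x _; rewrite leey.
  - apply: filterS G_lim => x + [/= qx Gx].
    have fx : 0 < f x.
      rewrite lt_neqAle f0 andbT; apply: contraTneq qx => fx.
      by have /andP[_] := qCf x; rewrite -fx mulr0 -leNgt.
    move=> /(_ fx); rewrite Gx => g0.
    apply/cvgeyPge => A; pose A' := Num.max A 0 / q x.
    have e0 : 0 < expR (- A' / 2) by exact: expR_gt0.
    have /cvgrPdist_lt/(_ _ e0) := g0.
    apply: filterS => k; rewrite sub0r normrN ger0_norm// ltr_expR => wA.
    have {}wA : A' <= - w_ k x by lra.
    rewrite lee_fin; apply: (@le_trans _ _ (q x * A')).
      by rewrite /A' mulrC divfK ?gt_eqF// le_max lexx.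
    by rewrite ler_wpM2l// le_max wA.
  - move=> k; apply: (@le_trans _ _ (\int[mu]_x h k x)%E).
      exact: ge0_subset_integral.
    rewrite bm_EFin// lee_fin; have [Wk Jk] := w_P k.
    apply: le_trans (J_coercive Wk) _.
    have : del k ^+ 2 <= 1 by rewrite exprn_ile1 ?(ltW (del_gt0 _)).
    lra.
rewrite integral_cst//= => muN.
have N0 : mu N = 0%E.
  apply/eqP; move: muN; have [//|N0] := eqVneq (mu N) 0%E.
  by rewrite gt0_mulye ?leye_eq// lt_neqAle eq_sym N0 measure_ge0.
have : {ae mu, forall x, ~ N x}.
  exists N; split => // x /= NNx; exact: contrapT.
apply: filterS2 q_gt0 => x qx Nx /qx{}qx.
rewrite lt_neqAle G_ge0 andbT eq_sym; apply/eqP => Gx; exact: Nx.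
Qed.

Let L2_lim n : (\int[mu]_x (f x * (g n x - G x) ^+ 2)%:E <= (2 * del n ^+ 2)%:E)%E.
Proof.
have mD : measurable_fun setT (fun x => (f x * (g n x - G x) ^+ 2)%:E).
  apply/measurable_EFinP/measurable_funM; first by case: bf.
  apply: measurable_funX; apply: measurable_funB => //; by case: (bg n).
apply: (@fatou_bound _ _ _ mu setT (fun k x => (f x * (g n x - g (k + n)%N x) ^+ 2)%:E)) => //.
- by move=> k; apply/measurable_EFinP/bm_meas; bounded_mfun_tac.
- by move=> k x _; rewrite lee_fin mulr_ge0// sqr_ge0.
- by move=> x _; rewrite lee_fin mulr_ge0// sqr_ge0.
- apply: filterS G_lim => x Gx _.
  have [fx|fx] := ltP 0 (f x); last first.
    have -> : f x = 0 by apply/eqP; rewrite eq_le fx f0.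
    by under eq_fun do rewrite mul0r; rewrite mul0r; exact: cvg_cst.
  apply: cvg_EFin; first exact: nearW.
  have gG : g (k + n)%N x @[k --> \oo] --> G x by have := Gx fx; rewrite -(cvg_shiftn n).
  have gB : g n x - g (k + n)%N x @[k --> \oo] --> g n x - G x.
    by apply: cvgB => //; exact: cvg_cst.
  by apply: cvgM; [exact: cvg_cst|exact: (cvgM gB gB)].
- move=> k; rewrite bm_EFin; [|exact: measurableT|by bounded_mfun_tac].
  rewrite lee_fin (le_trans (parallelogram _ _))//.
  rewrite mulr_natl mulr2n lerD2l ler_sqr ?nnegrE ?(ltW (del_gt0 _))//.
  by rewrite /del exprD ler_piMl ?exprn_ge0 ?invr_ge0// exprn_ile1 ?invr_ge0// invf_le1// ler1n.
Qed.

(* Lets L^2(f)-closeness of g n and G control the integrals of their squares on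
   every set, up to a factor close to 1. *)
Let young (h1 h2 : T -> R) A t : measurable A -> 0 < t ->
  measurable_fun setT h1 -> measurable_fun setT h2 ->
  (\int[mu]_(x in A) (f x * h1 x ^+ 2)%:E <=
   (1 + t)%:E * \int[mu]_(x in A) (f x * h2 x ^+ 2)%:E +
   (1 + t^-1)%:E * \int[mu]_x (f x * (h1 x - h2 x) ^+ 2)%:E)%E.
Proof.
move=> mA t0 mh1 mh2.
have mf : measurable_fun setT f by case: bf.
have mfh (h : T -> R) : measurable_fun setT h -> measurable_fun setT (fun x => (f x * h x ^+ 2)%:E).
  by move=> mh; apply/measurable_EFinP/measurable_funM => //; exact: measurable_funX.
have mfhA (h : T -> R) : measurable_fun setT h -> measurable_fun A (fun x => (f x * h x ^+ 2)%:E).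
  by move=> mh; apply: measurable_funTS; exact: mfh.
have fh0 (h : T -> R) x : (0 <= (f x * h x ^+ 2)%:E)%E.
  by rewrite lee_fin mulr_ge0// sqr_ge0.
have mB : measurable_fun setT (fun x => h1 x - h2 x) by exact: measurable_funB.
have t1 : 0 <= 1 + t by rewrite addr_ge0// ltW.
have t2 : 0 <= 1 + t^-1 by rewrite addr_ge0// invr_ge0 ltW.
apply: (@le_trans _ _ ((1 + t)%:E * \int[mu]_(x in A) (f x * h2 x ^+ 2)%:E +
   (1 + t^-1)%:E * \int[mu]_(x in A) (f x * (h1 x - h2 x) ^+ 2)%:E)%E); last first.
  rewrite leeD2l// lee_wpmul2l ?lee_fin//.
  apply: ge0_subset_integral => //; first exact: (mfh _ mB).
  by move=> x _; exact: (fh0 (fun x => h1 x - h2 x)).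
rewrite -ge0_integralZl_EFin//; [|exact: (mfhA _ mh2)].
rewrite -ge0_integralZl_EFin//; last 2 first.
- by move=> x _; exact: (fh0 (fun x => h1 x - h2 x)).
- exact: (mfhA _ mB).
rewrite -ge0_integralD//; last first.
- by apply: measurable_funeM; exact: (mfhA _ mB).
- by move=> x _; apply: mule_ge0; [rewrite lee_fin|exact: (fh0 (fun x => h1 x - h2 x))].
- by apply: measurable_funeM; exact: (mfhA _ mh2).
- by move=> x _; apply: mule_ge0; [rewrite lee_fin|exact: fh0].
apply: ge0_le_integral => //; [exact: (mfhA _ mh1)| |].
  by apply: emeasurable_funD; apply: measurable_funeM;
    [exact: (mfhA _ mh2)|exact: (mfhA _ mB)].
move=> x _; rewrite -!EFinM -EFinD lee_fin -subr_ge0.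
have -> : (1 + t) * (f x * h2 x ^+ 2) + (1 + t^-1) * (f x * (h1 x - h2 x) ^+ 2)
   - f x * h1 x ^+ 2 = f x * (t * (h2 x - t^-1 * (h1 x - h2 x)) ^+ 2).
  by field; rewrite gt_eqF.
by apply: mulr_ge0 => //; apply: mulr_ge0; [exact: ltW|exact: sqr_ge0].
Qed.

(* Perturbing w_n by t 1_A cannot decrease J below its infimum. In the limit
   (e^t - 1) P >= t Q for all t, where P and Q are the two integrals over A. *)
Let marginal (A : set T) : measurable A ->
  (forall v t, W v -> W (fun x => v x + t * \1_A x)) ->
  (\int[mu]_(x in A) (f x * G x ^+ 2)%:E = \int[mu]_(x in A) (q x)%:E)%E.
Proof.
move=> mA WA.
have mg n : measurable_fun setT (g n) by case: (bg n).
pose a n := \int[mu]_(x in A) (f x * g n x ^+ 2).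
have aEf n : (\int[mu]_(x in A) (f x * g n x ^+ 2)%:E = (a n)%:E)%E.
  by rewrite bm_EFin//; bounded_mfun_tac.
set aE := (\int[mu]_(x in A) _)%E.
have aE0 : (0 <= aE)%E.
  by apply: integral_ge0 => x _; rewrite lee_fin mulr_ge0// sqr_ge0.
have err n : ((1 + (del n)^-1)%:E * (2 * del n ^+ 2)%:E <= (4 * del n)%:E)%E.
  rewrite -EFinM lee_fin; have dn := del_gt0 n; have dn1 := del_le1 n.
  have -> : (1 + (del n)^-1) * (2 * del n ^+ 2) = 2 * (del n * del n) + 2 * del n.
    by field; rewrite gt_eqF.
  have : del n * del n <= del n by rewrite ler_piMl// ltW.
  lra.
have dV n : (0 <= (1 + (del n)^-1)%:E)%E.
  by rewrite lee_fin addr_ge0// invr_ge0 ltW.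
have up n : (aE <= (1 + del n)%:E * (a n)%:E + (4 * del n)%:E)%E.
  apply: le_trans (young mA (del_gt0 n) mG (mg n)) _.
  rewrite aEf leeD2l//; apply: le_trans (err n); rewrite lee_wpmul2l//.
  apply: le_trans (L2_lim n); rewrite le_eqVlt; apply/orP; left; apply/eqP.
  by apply: eq_integral => x _; rewrite -sqrrN opprB.
have lo n : ((a n)%:E <= (1 + del n)%:E * aE + (4 * del n)%:E)%E.
  rewrite -aEf; apply: le_trans (young mA (del_gt0 n) (mg n) mG) _.
  by rewrite leeD2l//; apply: le_trans (err n); rewrite lee_wpmul2l.
have aE_fin : aE \is a fin_num.
  by rewrite ge0_fin_numE// (le_lt_trans (up 0%N))// -EFinM -EFinD ltry.
pose P := fine aE; have PE : aE = P%:E by rewrite fineK.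
have P0 : 0 <= P by rewrite fine_ge0.
have {}up n : P <= (1 + del n) * a n + 4 * del n.
  by have := up n; rewrite PE -EFinM -EFinD lee_fin.
have {}lo n : a n <= (1 + del n) * P + 4 * del n.
  by have := lo n; rewrite PE -EFinM -EFinD lee_fin.
have a0 n : 0 <= a n by apply: bm_int_ge0 => x; rewrite mulr_ge0// sqr_ge0.
have close n : `|a n - P| <= del n * (3 * P + 8).
  have dn := del_gt0 n; have dn1 := del_le1 n.
  have h1 := up n; have h2 := lo n.
  have h3 : del n * P <= P by rewrite ler_piMl.
  have h4 : a n <= 2 * P + 4 by lra.
  have h5 : del n * a n <= del n * (2 * P + 4) by rewrite ler_wpM2l// ltW.
  have h6 : 0 <= del n * P by rewrite mulr_ge0// ltW.
  rewrite ler_norml; apply/andP; split; lra.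
pose Q := \int[mu]_(x in A) q x.
have Q0 : 0 <= Q by exact: bm_int_ge0.
rewrite bm_EFin// -/Q PE; congr EFin.
apply: expR_tangent_eq => // t.
apply: (@le_geometric _ _ _ (1 + `|expR t - 1| * (3 * P + 8))) => n.
have [Wn Jn] := w_P n.
have bA : bounded_mfun (\1_A : T -> R) by exact: bm_indic.
have : m <= J (w_ n) + ((expR t - 1) * a n - t * Q).
  apply: le_trans (m_le (WA _ t Wn)) _.
  rewrite le_eqVlt; apply/orP; left; apply/eqP.
  rewrite /a /Q /J (Rintegral_indic mu A q) (Rintegral_indic mu A (fun x => f x * g n x ^+ 2)).
  rewrite -bm_intZ; [|by first [exact: measurableT|bounded_mfun_tac]..].
  rewrite -bm_intZ; [|by first [exact: measurableT|bounded_mfun_tac]..].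
  rewrite -bm_intB; [|by first [exact: measurableT|bounded_mfun_tac]..].
  rewrite -bm_intD; [|by first [exact: measurableT|bounded_mfun_tac]..].
  apply: eq_Rintegral => x _; rewrite -g2.
  have -> : expR (w_ n x + t * \1_A x) = g n x ^+ 2 * (1 + (expR t - 1) * \1_A x).
    rewrite expRD -g2 indicE; case: (x \in A); rewrite ?mulr1 ?mulr0 ?expR0.
      by rewrite addrC subrK.
    by rewrite addr0.
  ring.
have h2 : (expR t - 1) * (a n - P) <= `|expR t - 1| * (del n * (3 * P + 8)).
  by rewrite (le_trans (ler_norm _))// normrM ler_wpM2l.
have h3 : del n ^+ 2 <= del n by rewrite expr2 ler_piMl// ltW.
rewrite -/(del n) mulrDr mulr1 mulrCA; move: h2; rewrite mulrBr.
move: h3 Jn; lra.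
Qed.

Lemma projection_of_sequence : exists w : T -> R,
  [/\ measurable_fun setT w,
      {ae mu, forall x, 0 < f x -> w_ ^~ x @ \oo --> w x}
    & forall A, measurable A -> (forall v t, W v -> W (fun x => v x + t * \1_A x)) ->
      (\int[mu]_(x in A) (f x * expR (w x))%:E = \int[mu]_(x in A) (q x)%:E)%E].
Proof.
pose w x := 2 * ln (G x).
have mw : measurable_fun setT w.
  apply: measurable_funM => //; exact: measurableT_comp.
exists w; split => //.
- apply: filterS2 G_lim G_gt0 => x Gl Gp fx.
  have wE n : w_ n x = 2 * ln (g n x) by rewrite /g expRK; field.
  under eq_fun do rewrite wE.
  apply: cvgMr; apply: (cvg_comp _ _ (Gl fx)).
  by apply: continuous_ln; exact: Gp.
- move=> A mA WA; rewrite -marginal//.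
  have mf : measurable_fun setT f by case: bf.
  apply: ge0_ae_eq_integral => //.
  + apply: measurable_funTS; apply/measurable_EFinP/measurable_funM => //.
    exact: measurableT_comp.
  + apply: measurable_funTS; apply/measurable_EFinP/measurable_funM => //.
    exact: measurable_funX.
  + by move=> x _; rewrite lee_fin mulr_ge0// expR_ge0.
  + by move=> x _; rewrite lee_fin mulr_ge0// sqr_ge0.
  apply: filterS G_gt0 => x Gx _; have [fx|fx] := ltP 0 (f x); last first.
    have -> : f x = 0 by apply/eqP; rewrite eq_le fx f0.
    by rewrite !mul0r.
  by rewrite /w mulr_natl mulr2n expRD -expr2 lnK// posrE Gx.
Qed.

End WithSequence.

(** Minimizing sequences of J converge, and their limit w satisfies the
    first-order conditions of the minimum although it need not be in W. *)
Lemma entropy_projection : exists (w_ : nat -> T -> R) (w : T -> R),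
  [/\ forall n, W (w_ n), measurable_fun setT w,
      {ae mu, forall x, 0 < f x -> w_ ^~ x @ \oo --> w x}
    & forall A, measurable A -> (forall v t, W v -> W (fun x => v x + t * \1_A x)) ->
      (\int[mu]_(x in A) (f x * expR (w x))%:E = \int[mu]_(x in A) (q x)%:E)%E].
Proof.
have [w_ w_P] := minimizing; have [w [mw w_w wA]] := projection_of_sequence w_P.
by exists w_, w; split => // n; case: (w_P n).
Qed.

End EntropyProjection.

(** * Limits of sums u(x) + v(y) *)

Lemma cvg_finsum (R : realType) (I : finType) (F : nat -> I -> R) (l : I -> R) :
  (forall i, F t i @[t --> \oo] --> l i) ->
  \sum_i F t i @[t --> \oo] --> \sum_i l i.
Proof.
by move=> Fl; apply: cvg_big => //; exact: add_continuous.
Qed.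

(** The families (k_i + l_j), indexed by the convergent pairs (i, j), form the
    row space of a matrix, which is closed as the kernel of another matrix. The
    sequences a_i and b_j themselves may diverge. *)
Lemma split_limits (R : realType) m n (a : nat -> 'I_m -> R) (b : nat -> 'I_n -> R) :
  exists (k : 'I_m -> R) (l : 'I_n -> R), forall i j (L : R),
    a t i + b t j @[t --> \oo] --> L -> L = k i + l j.
Proof.
pose P : finType := ('I_m * 'I_n)%type.
pose ed (p : P) : bool := `[< cvgn (fun t => a t p.1 + b t p.2) >].
pose B : 'M[R]_(m + n, #|P|) := \matrix_(s, p)
  (ed (enum_val p) && match fintype.split s with
     | inl i => i == (enum_val p).1 | inr j => j == (enum_val p).2 end)%:R.
pose xrow (u : 'I_m -> R) (v : 'I_n -> R) : 'rV[R]_(m + n) :=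
  \row_s match fintype.split s with inl i => u i | inr j => v j end.
have pick1 (I : finType) (F : I -> R) i0 (c : bool) :
    \sum_i F i * (c && (i == i0))%:R = c%:R * F i0.
  rewrite (bigD1 i0)//= eqxx andbT big1 ?addr0; first by rewrite mulrC.
  by move=> i /negPf ->; rewrite andbF mulr0.
have xB u v p : (xrow u v *m B) 0 p =
    (ed (enum_val p))%:R * (u (enum_val p).1 + v (enum_val p).2).
  rewrite mxE big_split_ord/=.
  under eq_bigr => i _.
    rewrite !mxE (unsplitK (inl i)); over.
  under [X in _ + X]eq_bigr => j _.
    rewrite !mxE (unsplitK (inr j)); over.
  by rewrite !pick1 mulrDr.
pose c : 'rV[R]_#|P| := \row_p
  ((ed (enum_val p))%:R * limn (fun t => a t (enum_val p).1 + b t (enum_val p).2)).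
have yc p : (xrow (a t) (b t) *m B) 0 p @[t --> \oo] --> c 0 p.
  rewrite (_ : (fun t => _) = fun t =>
      (ed (enum_val p))%:R * (a t (enum_val p).1 + b t (enum_val p).2)); last first.
    by apply/funext => t; rewrite xB.
  rewrite mxE; case: (boolP (ed (enum_val p))) => [/asboolP ep|_].
    by apply: cvgMr; exact: ep.
  rewrite mul0r; rewrite (_ : (fun t => _) = cst 0); first exact: cvg_cst.
  by apply/funext => t; rewrite mul0r.
have : (c <= B)%MS.
  rewrite submxE; apply/eqP/rowP => q; rewrite [RHS]mxE mxE.
  have lim1 : \sum_p (xrow (a t) (b t) *m B) 0 p * cokermx B p q @[t --> \oo] -->
      \sum_p c 0 p * cokermx B p q.
    by apply: cvg_finsum => p; apply: cvgMl; exact: yc.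
  have lim0 : \sum_p (xrow (a t) (b t) *m B) 0 p * cokermx B p q @[t --> \oo] --> (0 : R).
    rewrite (_ : (fun t => _) = cst 0); first exact: cvg_cst.
    apply/funext => t /=.
    have := congr1 (fun M : 'rV[R]__ => M 0 q) (mulmxA (xrow (a t) (b t)) B (cokermx B)).
    by rewrite mulmx_coker mulmx0 [LHS]mxE [X in _ = X]mxE => <-.
  exact: (cvg_unique _ lim1 lim0).
move=> /submxP[D cD].
exists (fun i => D 0 (lshift n i)), (fun j => D 0 (rshift m j)) => i j L aL.
have eij : ed (i, j) by apply/asboolP; apply/cvg_ex; exists L.
have DE : D = xrow (fun i => D 0 (lshift n i)) (fun j => D 0 (rshift m j)).
  apply/rowP => s; rewrite mxE; rewrite -{1}(splitK s).
  by case: (fintype.split s).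
rewrite DE in cD.
have := congr1 (fun M : 'rV[R]__ => M 0 (enum_rank (i, j))) cD.
rewrite xB mxE !enum_rankK eij !mul1r/= => limE.
rewrite -limE.
exact/esym/cvg_lim.
Qed.

Lemma ae_exists d (T : measurableType d) (R : realType)
    (mu : {measure set T -> \bar R}) (A : set T) (P : T -> Prop) :
  measurable A -> (0 < mu A)%E -> {ae mu, forall x, P x} -> exists2 x, A x & P x.
Proof.
move=> mA A0 aeP; apply: contrapT => nex; apply: (ae_not_null mA A0).
by apply: filterS aeP => x Px Ax; apply: nex; exists x.
Qed.

Section AdditiveLimit.
Context d1 d2 (X : measurableType d1) (Y : measurableType d2) (R : realType).
Variables (muX : {finite_measure set X -> \bar R})
          (muY : {finite_measure set Y -> \bar R}).
Local Notation muXY := (prod_measure muX muY).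

(** Choose y_i in F_i and x_j in G_j such that the sections of w through them
    are limits. For (x, y) in S, x in E_i and y in H_j,

      w (x, y) = w (x, y_i) + w (x_j, y) - lim (v_k (y_i) + u_k (x_j)),

    where [split_limits] writes the last limit as k_i + l_j. *)
Lemma additive_limit (S : set (X * Y)) m n
    (E : 'I_m -> set X) (F : 'I_m -> set Y)
    (G : 'I_n -> set X) (H : 'I_n -> set Y)
    (u_ : nat -> X -> R) (v_ : nat -> Y -> R) (w : X * Y -> R) :
  (forall i, measurable (E i)) -> (forall i, measurable (F i)) ->
  (forall j, measurable (G j)) -> (forall j, measurable (H j)) ->
  (forall i, (0 < muY (F i))%E) -> (forall j, (0 < muX (G j))%E) ->
  (forall i, {ae muXY, forall z, E i z.1 -> F i z.2 -> S z}) ->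
  (forall j, {ae muXY, forall z, G j z.1 -> H j z.2 -> S z}) ->
  {ae muXY, forall z, S z -> (\bigcup_i E i) z.1 /\ (\bigcup_j H j) z.2} ->
  measurable_fun setT w ->
  {ae muXY, forall z, S z -> u_ k z.1 + v_ k z.2 @[k --> \oo] --> w z} ->
  exists (u : X -> R) (v : Y -> R),
    [/\ measurable_fun setT u, measurable_fun setT v
      & {ae muXY, forall z, S z -> w z = u z.1 + v z.2}].
Proof.
move=> mE mF mG mH F0 G0 SEF SGH cover mw Sw.
have [e [be e01 eE e1]] := partition_of_unity R mE.
have [h [bh h01 hH h1]] := partition_of_unity R mH.
have /choice[y yP] : forall i, exists y, F i y /\
    {ae muX, forall x, E i x -> u_ k x + v_ k y @[k --> \oo] --> w (x, y)}.
  move=> i; have ES : {ae muXY, forall z, E i z.1 -> F i z.2 ->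
      u_ k z.1 + v_ k z.2 @[k --> \oo] --> w z}.
    by apply: filterS2 (SEF i) Sw => z zS Sz Ez Fz; exact/Sz/zS.
  have [y Fy yP] := ae_exists (mF i) (F0 i) (ae_section2 ES).
  by exists y; split => //; apply: filterS yP => x /= + Ex => /(_ Ex Fy).
have /choice[x xP] : forall j, exists x, G j x /\
    {ae muY, forall y, H j y -> u_ k x + v_ k y @[k --> \oo] --> w (x, y)}.
  move=> j; have GS : {ae muXY, forall z, G j z.1 -> H j z.2 ->
      u_ k z.1 + v_ k z.2 @[k --> \oo] --> w z}.
    by apply: filterS2 (SGH j) Sw => z zS Sz Gz Hz; exact/Sz/zS.
  have [x Gx xP] := ae_exists (mG j) (G0 j) (ae_section1 GS).
  by exists x; split => //; apply: filterS xP => y' /= + Hy => /(_ Gx Hy).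
have [k [l kl]] := split_limits (fun t i => v_ t (y i)) (fun t j => u_ t (x j)).
pose U i x' := w (x', y i) - k i.
pose V j y' := w (x j, y') - l j.
have mU i : measurable_fun setT (U i).
  by apply: measurable_funB => //; exact: measurable_fun_pair1.
have mV j : measurable_fun setT (V j).
  by apply: measurable_funB => //; exact: measurable_fun_pair2.
exists (fun x' => \sum_i e i x' * U i x'), (fun y' => \sum_j h j y' * V j y'); split.
- by apply: measurable_sum => i; apply: measurable_funM => //; case: (be i).
- by apply: measurable_sum => j; apply: measurable_funM => //; case: (bh j).
have xE : {ae muXY, forall z, forall i, E i z.1 ->
    u_ k z.1 + v_ k (y i) @[k --> \oo] --> w (z.1, y i)}.
  by apply: ae_forall_fin => i; case: (yP i) => _ /ae_fst; apply.
have yH : {ae muXY, forall z, forall j, H j z.2 ->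
    u_ k (x j) + v_ k z.2 @[k --> \oo] --> w (x j, z.2)}.
  by apply: ae_forall_fin => j; case: (xP j) => _ /ae_snd; apply.
apply: filterS2 (filterI xE yH) (filterI Sw cover) => z [zE zH] [zw zc] Sz.
have {}zw := zw Sz; have [Ez Hz] := zc Sz.
have UV i j : E i z.1 -> H j z.2 -> w z = U i z.1 + V j z.2.
  move=> Ei Hj; have : v_ t (y i) + u_ t (x j) @[t --> \oo] -->
      (w (z.1, y i) + w (x j, z.2)) - w z.
    rewrite (_ : (fun t => _) = fun t =>
      (u_ t z.1 + v_ t (y i)) + (u_ t (x j) + v_ t z.2) - (u_ t z.1 + v_ t z.2)).
      by apply: cvgB zw; apply: cvgD; [exact: zE|exact: zH].
    by apply/funext => t; ring.
  by move/kl => kl'; rewrite /U /V; lra.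
(* Every pair of indices gives the same decomposition at z, so averaging over
   the two partitions of unity does as well. *)
have wE : w z = (\sum_i e i z.1) * (\sum_j h j z.2) * w z.
  by rewrite e1// h1// !mul1r.
rewrite wE -[X in _ = X + _]mulr1 -(h1 _ Hz) -[X in _ = _ + X]mul1r -(e1 _ Ez).
rewrite !big_distrlr/= mulr_suml -big_split/=; apply: eq_bigr => i _.
rewrite mulr_suml -big_split/=; apply: eq_bigr => j _.
have [->|/eE Ei] := eqVneq (e i z.1) 0; first by rewrite !mul0r addr0.
have [->|/hH Hj] := eqVneq (h j z.2) 0; first by rewrite !(mul0r,mulr0) addr0.
by rewrite (UV i j)//; ring.
Qed.

End AdditiveLimit.

(** * Scaling to prescribed marginals *)

Section Scaling.
Context d1 d2 (X : measurableType d1) (Y : measurableType d2) (R : realType).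
Variables (muX : {finite_measure set X -> \bar R})
          (muY : {finite_measure set Y -> \bar R}).
Local Notation muXY := (prod_measure muX muY).

Variables (f g : X * Y -> R) (c : R) (m n : nat).
Variables (E : 'I_m -> set X) (F : 'I_m -> set Y).
Variables (G : 'I_n -> set X) (H : 'I_n -> set Y).
Hypotheses (bf : bounded_mfun f) (bg : bounded_mfun g) (f0 : forall z, 0 <= f z)
  (g0 : forall z, 0 <= g z).
Hypothesis fg : {ae muXY, forall z, (0 < f z) <-> (0 < g z)}.
Hypothesis c0 : 0 < c.
Hypotheses (mE : forall i, measurable (E i)) (mF : forall i, measurable (F i)).
Hypotheses (mG : forall j, measurable (G j)) (mH : forall j, measurable (H j)).
Hypotheses (F0 : forall i, (0 < muY (F i))%E) (G0 : forall j, (0 < muX (G j))%E).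
Hypothesis fEF : forall i, {ae muXY, forall z, E i z.1 -> F i z.2 -> c <= f z}.
Hypothesis fGH : forall j, {ae muXY, forall z, G j z.1 -> H j z.2 -> c <= f z}.
Hypothesis cover : {ae muXY, forall z, 0 < f z ->
  (\bigcup_i E i) z.1 /\ (\bigcup_j H j) z.2}.

(** With respect to a competitor q of g, the limit w of a minimizing sequence of
    bounded sums u_k (x) + v_k (y) is a sum u (x) + v (y), and the sets
    A x Y and X x B are those along which w can be perturbed. *)
Theorem marginal_scaling : exists (u : X -> R) (v : Y -> R),
  [/\ measurable_fun setT u, measurable_fun setT v,
      forall A, measurable A ->
        (\int[muXY]_(z in A `*` setT) (f z * expR (u z.1 + v z.2))%:E =
         \int[muXY]_(z in A `*` setT) (g z)%:E)%E
    & forall B, measurable B ->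
        (\int[muXY]_(z in setT `*` B) (f z * expR (u z.1 + v z.2))%:E =
         \int[muXY]_(z in setT `*` B) (g z)%:E)%E].
Proof.
have [q [C [bq [C0 qC] q_gt0 qX qY]]] :=
  competitor bf bg f0 g0 fg c0 mE mF mG mH F0 G0 fEF fGH cover.
pose W : set (X * Y -> R) := [set w | exists u v,
  [/\ bounded_mfun u, bounded_mfun v & w = fun z => u z.1 + v z.2]].
have W_neq0 : W !=set0.
  by exists (fun z => 0 + 0), (fun=> 0), (fun=> 0); split=> //; exact: bm_cst.
have bW w : W w -> bounded_mfun w by move=> [u [v [bu bv ->]]]; bounded_mfun_tac.
have W_mid w1 w2 : W w1 -> W w2 -> W (fun z => (w1 z + w2 z) / 2).
  move=> [u1 [v1 [bu1 bv1 ->]]] [u2 [v2 [bu2 bv2 ->]]].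
  exists (fun x => (u1 x + u2 x) * 2^-1), (fun y => (v1 y + v2 y) * 2^-1).
  by split; [bounded_mfun_tac..|apply/funext => z; field].
have [w_ [w [Ww mw w_w wA]]] :=
  entropy_projection bf bq C0 f0 qC q_gt0 W_neq0 bW W_mid.
have /choice[u_ /choice[v_ uvP]] : forall k, exists u v,
    [/\ bounded_mfun u, bounded_mfun v & w_ k = fun z => u z.1 + v z.2] by move=> k; exact: Ww.
have [u [v [mu mv wE]]] : exists (u : X -> R) (v : Y -> R),
    [/\ measurable_fun setT u, measurable_fun setT v
      & {ae muXY, forall z, 0 < f z -> w z = u z.1 + v z.2}].
  apply: (@additive_limit _ _ _ _ _ muX muY [set z | 0 < f z] m n E F G H u_ v_) => //.
  - by move=> i; apply: filterS (fEF i) => z + Ez Fz => /(_ Ez Fz); exact: lt_le_trans.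
  - by move=> j; apply: filterS (fGH j) => z + Gz Hz => /(_ Gz Hz); exact: lt_le_trans.
  - apply: filterS w_w => z + fz => /(_ fz); rewrite (_ : w_ ^~ z = fun k => u_ k z.1 + v_ k z.2)//.
    by apply/funext => k; case: (uvP k) => _ _ ->.
have mf : measurable_fun setT f by case: bf.
have fwE D : measurable D ->
    (\int[muXY]_(z in D) (f z * expR (u z.1 + v z.2))%:E =
     \int[muXY]_(z in D) (f z * expR (w z))%:E)%E.
  move=> mD; apply: ge0_ae_eq_integral => //.
  - apply: measurable_funTS; apply/measurable_EFinP/measurable_funM => //.
    apply: measurableT_comp => //; apply: measurable_funD.
      exact: (measurableT_comp mu).
    exact: (measurableT_comp mv).
  - apply: measurable_funTS; apply/measurable_EFinP/measurable_funM => //.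
    exact: measurableT_comp.
  - by move=> z _; rewrite lee_fin mulr_ge0// expR_ge0.
  - by move=> z _; rewrite lee_fin mulr_ge0// expR_ge0.
  apply: filterS wE => z wz _; have [fz|fz] := ltP 0 (f z); first by rewrite wz.
  have -> : f z = 0 by apply/eqP; rewrite eq_le fz f0.
  by rewrite !mul0r.
exists u, v; split => //.
- move=> A mA; have mD : measurable (A `*` [set: Y]) by exact: measurableX.
  have indA (z : X * Y) : \1_(A `*` [set: Y]) z = \1_A z.1 :> R.
    by rewrite !indicE in_setX in_setT andbT.
  rewrite fwE// wA//; last first.
    move=> _ t [u1 [v1 [bu1 bv1 ->]]].
    exists (fun x => u1 x + t * \1_A x), v1; split => //; first by bounded_mfun_tac.
    by apply/funext => z; rewrite indA; ring.
  rewrite !bm_EFin//; congr EFin; rewrite (Rintegral_indic muXY (A `*` setT) q).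
  rewrite (Rintegral_indic muXY (A `*` setT) g).
  rewrite (@eq_Rintegral _ _ _ _ _ (fun z => q z * \1_A z.1)); last by move=> z _; rewrite indA.
  rewrite qX; last exact: bm_indic.
  by apply: eq_Rintegral => z _; rewrite indA.
- move=> A mA; have mD : measurable ([set: X] `*` A) by exact: measurableX.
  have indA (z : X * Y) : \1_([set: X] `*` A) z = \1_A z.2 :> R.
    by rewrite !indicE in_setX in_setT.
  rewrite fwE// wA//; last first.
    move=> _ t [u1 [v1 [bu1 bv1 ->]]].
    exists u1, (fun x => v1 x + t * \1_A x); split => //; first by bounded_mfun_tac.
    by apply/funext => z; rewrite indA; ring.
  rewrite !bm_EFin//; congr EFin; rewrite (Rintegral_indic muXY (setT `*` A) q).
  rewrite (Rintegral_indic muXY (setT `*` A) g).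
  rewrite (@eq_Rintegral _ _ _ _ _ (fun z => q z * \1_A z.2)); last by move=> z _; rewrite indA.
  rewrite qY; last exact: bm_indic.
  by apply: eq_Rintegral => z _; rewrite indA.
Qed.

End Scaling.

(** * Densities between measures *)

Local Open Scope charge_scope.

(** Unlike the derivative, k is nonnegative and measurable everywhere, so that it
    can be multiplied and restricted without almost sure conditions. *)
Definition has_density d (T : measurableType d) (R : realType)
    (nu mu : {measure set T -> \bar R}) (k : T -> R) : Prop :=
  [/\ measurable_fun setT k, forall x, 0 <= k x
    & forall A, measurable A -> nu A = (\int[mu]_(x in A) (k x)%:E)%E].

Section Density.
Context d (T : measurableType d) (R : realType).
Implicit Types (mu : {sigma_finite_measure set T -> \bar R})
  (nu N : {finite_measure set T -> \bar R}).

Lemma has_density_mEFin (nu mu : {measure set T -> \bar R}) k A :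
  has_density nu mu k -> measurable_fun A (fun x => (k x)%:E).
Proof. by move=> [mk _ _]; apply: measurable_funTS; apply/measurable_EFinP. Qed.

Lemma has_density_dominates (nu mu : {measure set T -> \bar R}) k :
  has_density nu mu k -> nu `<< mu.
Proof.
move=> [mk k0 nuE]; apply/null_content_dominatesP => A mA muA0.
rewrite nuE//; apply: null_set_integral => //.
by apply/measurable_EFinP; exact: measurable_funTS.
Qed.

Lemma ae_dominates (nu mu : {measure set T -> \bar R}) (P : T -> Prop) :
  nu `<< mu -> {ae mu, forall x, P x} -> {ae nu, forall x, P x}.
Proof.
move=> /null_content_dominatesP numu [A [mA A0 PA]].
by exists A; split => //; exact: numu.
Qed.

(** A null set of k mu is null for mu once k > 0 on it. *)
Lemma has_density_ae (nu mu : {measure set T -> \bar R}) k (P : T -> Prop) :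
  has_density nu mu k -> {ae nu, forall x, P x} ->
  {ae mu, forall x, 0 < k x -> P x}.
Proof.
move=> dk [A [mA A0 PA]]; have [mk k0 nuE] := dk.
have : (\int[mu]_(x in A) `|(k x)%:E| = 0)%E.
  by rewrite -[RHS]A0 nuE//; apply: eq_integral => x _; rewrite gee0_abs ?lee_fin.
move/(ae_eq_integral_abs mu mA (has_density_mEFin dk)).
apply: filterS => x kx kx0; apply: contrapT => Px.
by have := kx (PA _ Px) => -[] kx00; rewrite kx00 ltxx in kx0.
Qed.

Lemma has_density_gt0 (nu mu : {measure set T -> \bar R}) k :
  has_density nu mu k -> {ae nu, forall x, 0 < k x}.
Proof.
move=> [mk k0 nuE]; exists (k @^-1` [set 0]); split.
- by rewrite -[X in measurable X]setTI; apply: mk.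
- rewrite nuE; last by rewrite -[X in measurable X]setTI; apply: mk.
  by apply: integral0_eq => x /= ->.
- move=> x /= /negP; rewrite -leNgt => kx; apply/eqP.
  by rewrite eq_le kx k0.
Qed.

Lemma has_density_integrable nu (mu : {measure set T -> \bar R}) k :
  has_density nu mu k -> mu.-integrable setT (EFin \o k).
Proof.
move=> [mk k0 nuE]; apply/integrableP; split; first exact/measurable_EFinP.
under eq_integral do rewrite gee0_abs ?lee_fin//=.
by rewrite -nuE// ltey_eq fin_num_measure.
Qed.

Lemma has_density_unique nu (mu : {measure set T -> \bar R}) k1 k2 :
  has_density nu mu k1 -> has_density nu mu k2 -> {ae mu, forall x, k1 x = k2 x}.
Proof.
move=> dk1 dk2.
have : ae_eq mu setT (EFin \o k1) (EFin \o k2).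
  apply: integral_ae_eq => //.
  - exact: has_density_integrable dk1.
  - by case: dk2 => mk2 _ _; exact/measurable_EFinP.
  - by move=> A _ mA; case: dk1 => _ _ <-//; case: dk2 => _ _ <-.
by apply: filterS => x /(_ I)[].
Qed.

Lemma RN_ae nu mu k : has_density nu mu k ->
  {ae mu, forall x, 'd (charge_of_finite_measure nu) '/d mu x = (k x)%:E}.
Proof.
move=> dk; have numu := has_density_dominates dk.
have : ae_eq mu setT ('d (charge_of_finite_measure nu) '/d mu) (EFin \o k).
  apply: integral_ae_eq => //.
  - exact: Radon_Nikodym_integrable.
  - by case: dk => mk _ _; exact/measurable_EFinP.
  - by move=> A _ mA; rewrite -Radon_Nikodym_integral//; case: dk => _ _ <-.
by apply: filterS => x /(_ I).
Qed.

Lemma density_ae nu mu k : has_density nu mu k ->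
  {ae mu, forall x, density nu mu x = k x}.
Proof. by move=> /RN_ae; apply: filterS => x; rewrite /density => ->. Qed.

Lemma has_density_exists nu mu : nu `<< mu -> exists k, has_density nu mu k.
Proof.
move=> numu; pose k := Radon_Nikodym_SigmaFinite.f nu mu.
have k0 : forall x, (0 <= k x)%E by exact: Radon_Nikodym_SigmaFinite.f_ge0.
have kfin x : k x \is a fin_num by exact: Radon_Nikodym_SigmaFinite.f_fin_num.
exists (fine \o k); split.
- apply: measurableT_comp => //; apply: (measurable_int mu).
  exact: Radon_Nikodym_SigmaFinite.f_integrable.
- by move=> x; rewrite fine_ge0.
- move=> A mA; apply: etrans (Radon_Nikodym_SigmaFinite.f_integral numu mA) _.
  by apply: eq_integral => x _ /=; rewrite fineK.
Qed.

Lemma change_of_density nu mu k A (h : T -> \bar R) : has_density nu mu k ->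
  measurable A -> measurable_fun A h -> (forall x, 0 <= h x)%E ->
  (\int[nu]_(x in A) h x = \int[mu]_(x in A) (h x * (k x)%:E))%E.
Proof.
move=> dk mA mh h0; have numu := has_density_dominates dk.
rewrite -(Radon_Nikodym_SigmaFinite.change_of_variables numu)//.
have mf : measurable_fun A (Radon_Nikodym_SigmaFinite.f nu mu).
  apply: measurable_funTS; apply: (measurable_int mu).
  exact: Radon_Nikodym_SigmaFinite.f_integrable.
apply: ae_eq_integral => //.
- exact: emeasurable_funM.
- by apply: emeasurable_funM => //; exact: has_density_mEFin dk.
- apply: ae_eqe_mul2l; apply: integral_ae_eq => //.
  + apply: (integrableS measurableT) => //.
    exact: Radon_Nikodym_SigmaFinite.f_integrable.
  + exact: has_density_mEFin dk.
  + move=> B BA mB; case: dk => _ _ <-//.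
    by rewrite -Radon_Nikodym_SigmaFinite.f_integral.
Qed.

Lemma has_density_trans (la : {measure set T -> \bar R}) nu mu h k :
  has_density la nu h -> has_density nu mu k ->
  has_density la mu (fun x => h x * k x).
Proof.
move=> dh dk; have [mh h0 laE] := dh; have [mk k0 _] := dk; split.
- exact: measurable_funM.
- by move=> x; rewrite mulr_ge0.
- move=> A mA; rewrite laE// (change_of_density dk)//.
  exact: has_density_mEFin dh.
Qed.

(** Chain rule: d(nu)/d(N) times k is f, the density of nu. *)
Lemma density_ratio nu N mu f k :
  has_density nu mu f -> has_density N mu k -> nu `<< N ->
  {ae mu, forall x, 0 < k x -> density nu N x = f x / k x}.
Proof.
move=> df dk nuN; have [r dr] := has_density_exists nuN.
have rkf := has_density_unique (has_density_trans dr dk) df.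
have rk := has_density_ae dk (density_ae dr).
apply: filterS2 rkf rk => x /= <- + kx => /(_ kx) ->.
by rewrite mulfK// gt_eqF.
Qed.

End Density.

(** * Densities of marginals and of their products *)

Section Conditionals.
Context d1 d2 (X : measurableType d1) (Y : measurableType d2) (R : realType).
Variables (muX : {finite_measure set X -> \bar R})
          (muY : {finite_measure set Y -> \bar R}).
Local Notation muXY := (prod_measure muX muY).
Implicit Types (P Q : probability (X * Y)%type R) (p q : ac_distribution muX muY).

Lemma fst_preimage (A : set X) : fst @^-1` A = A `*` [set: Y].
Proof. by apply/seteqP; split => z //= []. Qed.

Lemma snd_preimage (B : set Y) : snd @^-1` B = [set: X] `*` B.
Proof. by apply/seteqP; split => z //= []. Qed.

Lemma marginalX_E P A : marginalX P A = P (A `*` setT).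
Proof. by rewrite -fst_preimage. Qed.

Lemma marginalY_E P A : marginalY P A = P (setT `*` A).
Proof. by rewrite -snd_preimage. Qed.

Lemma ae_marginalX P (S : X -> Prop) :
  {ae marginalX P, forall x, S x} -> {ae P, forall z, S z.1}.
Proof.
move=> [N [mN N0 PN]]; exists (N `*` setT); split.
- exact: measurableX.
- by rewrite -marginalX_E.
- by move=> z /= Pz; split => //; apply: PN.
Qed.

Lemma ae_marginalY P (S : Y -> Prop) :
  {ae marginalY P, forall y, S y} -> {ae P, forall z, S z.2}.
Proof.
move=> [N [mN N0 PN]]; exists (setT `*` N); split.
- exact: measurableX.
- by rewrite -marginalY_E.
- by move=> z /= Pz; split => //; apply: PN.
Qed.

Lemma marginalX_dominated p : marginalX p `<< muX.
Proof.
apply/null_content_dominatesP => A mA A0; rewrite marginalX_E.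
have /null_content_dominatesP := ac_dominated p; apply.
  exact: measurableX.
apply: etrans (product_measure1E muX muY mA measurableT) _.
by apply/eqP; rewrite mule_eq0; apply/orP; left; apply/eqP.
Qed.

Lemma marginalY_dominated p : marginalY p `<< muY.
Proof.
apply/null_content_dominatesP => A mA A0; rewrite marginalY_E.
have /null_content_dominatesP := ac_dominated p; apply.
  exact: measurableX.
apply: etrans (product_measure1E muX muY measurableT mA) _.
by apply/eqP; rewrite mule_eq0; apply/orP; right; apply/eqP.
Qed.

Lemma prod_densityX (rho : {finite_measure set X -> \bar R}) k :
  has_density rho muX k ->
  has_density (prod_measure rho muY) muXY (fun z => k z.1).
Proof.
move=> dk; have [mk k0 rhoE] := dk; split => //.
  exact: (measurableT_comp mk).
move=> A mA.
have mk1 : measurable_fun setT (fun z : X * Y => k z.1) by exact: (measurableT_comp mk).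
apply: (@etrans _ _ (\int[muX]_x (muY (xsection A x) * (k x)%:E))%E).
  apply: (change_of_density dk) => //; exact: measurable_fun_xsection.
rewrite integral_mkcond.
apply/esym; apply: etrans (@fubini_tonelli1 _ _ _ _ _ muX muY _ _ _) _.
- apply/(measurable_restrictT _ mA); apply/measurable_EFinP.
  exact: measurable_funTS.
- by move=> z; rewrite erestrict_ge0// => ? _; rewrite lee_fin.
apply: eq_integral => x _; rewrite /fubini_F.
transitivity (\int[muY]_y ((\1_(xsection A x) y)%:E * (k x)%:E))%E.
  apply: eq_integral => y _; rewrite patchE indicE mem_xsection.
  by case: ifP => _; rewrite ?mul1e ?mul0e.
rewrite ge0_integralZr//.
- by rewrite integral_indic ?setIT//; exact: measurable_xsection.
- by apply/measurable_EFinP; apply: measurable_indic; exact: measurable_xsection.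
- by rewrite lee_fin.
Qed.

Lemma prod_densityY (sigma : {finite_measure set Y -> \bar R}) k :
  has_density sigma muY k ->
  has_density (prod_measure muX sigma) muXY (fun z => k z.2).
Proof.
move=> dk; have [mk k0 rhoE] := dk; split => //.
  exact: (measurableT_comp mk).
move=> A mA.
have mk1 : measurable_fun setT (fun z : X * Y => k z.2) by exact: (measurableT_comp mk).
apply: (@etrans _ _ (\int[muY]_y (muX (ysection A y) * (k y)%:E))%E).
  apply: (@etrans _ _ ((muX \x^ sigma)%E A)).
    apply: product_measure_unique => // C B mC mB.
    exact: product_measure2E.
  apply: (change_of_density dk) => //; exact: measurable_fun_ysection.
rewrite integral_mkcond.
apply/esym; apply: etrans (@fubini_tonelli2 _ _ _ _ _ muX muY _ _ _) _.
- apply/(measurable_restrictT _ mA); apply/measurable_EFinP.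
  exact: measurable_funTS.
- by move=> z; rewrite erestrict_ge0// => ? _; rewrite lee_fin.
apply: eq_integral => y _; rewrite /fubini_G.
transitivity (\int[muX]_x ((\1_(ysection A y) x)%:E * (k y)%:E))%E.
  apply: eq_integral => x _; rewrite patchE indicE mem_ysection.
  by case: ifP => _; rewrite ?mul1e ?mul0e.
rewrite ge0_integralZr//.
- by rewrite integral_indic ?setIT//; exact: measurable_ysection.
- by apply/measurable_EFinP; apply: measurable_indic; exact: measurable_ysection.
- by rewrite lee_fin.
Qed.

Lemma marginalX_tilt P Q alpha : has_density Q P (fun z => alpha z.1) ->
  measurable_fun setT alpha -> (forall x, 0 <= alpha x) ->
  has_density (marginalX Q) (marginalX P) alpha.
Proof.
move=> [_ _ QE] ma a0; split => // A mA.
apply: etrans (marginalX_E Q A) _.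
apply: etrans (QE _ _) _; first exact: measurableX.
rewrite -fst_preimage; apply/esym.
apply: (ge0_integral_pushforward (phi := fst) measurable_fst) => //.
  by apply/measurable_EFinP; exact: measurable_funTS.
by move=> x _; rewrite lee_fin.
Qed.

Lemma marginalY_tilt P Q beta : has_density Q P (fun z => beta z.2) ->
  measurable_fun setT beta -> (forall x, 0 <= beta x) ->
  has_density (marginalY Q) (marginalY P) beta.
Proof.
move=> [_ _ QE] ma a0; split => // A mA.
apply: etrans (marginalY_E Q A) _.
apply: etrans (QE _ _) _; first exact: measurableX.
rewrite -snd_preimage; apply/esym.
apply: (ge0_integral_pushforward (phi := snd) measurable_snd) => //.
  by apply/measurable_EFinP; exact: measurable_funTS.
by move=> x _; rewrite lee_fin.
Qed.

(** A null set of N = k mu is null for mu where k > 0, and P gives no mass to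
    the points where k = 0. *)
Lemma dominated_by_marginal (N : {finite_measure set (X * Y)%type -> \bar R}) P k :
  P `<< muXY -> has_density N muXY k -> {ae P, forall z, 0 < k z} -> P `<< N.
Proof.
move=> pmu dk pk; apply/null_content_dominatesP => A mA A0.
have NA : {ae N, forall z, ~ A z}.
  by exists A; split => // z /= /contrapT.
have PA : {ae P, forall z, ~ A z}.
  apply: filterS2 (ae_dominates pmu (has_density_ae dk NA)) pk.
  by move=> z + kz => /(_ kz).
apply: contrapT => /eqP PA0; apply: (ae_not_null mA _ PA).
by rewrite lt_neqAle eq_sym PA0 measure_ge0.
Qed.

End Conditionals.

(** * Reweighting one coordinate preserves a conditional density *)

Section SameDependence.
Context d1 d2 (X : measurableType d1) (Y : measurableType d2) (R : realType).
Variables (muX : {finite_measure set X -> \bar R})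
          (muY : {finite_measure set Y -> \bar R}).
Local Notation muXY := (prod_measure muX muY).
Implicit Types (P Q : probability (X * Y)%type R) (p q : ac_distribution muX muY).

(** The conditional density of p is f / k, with k the density of its X-marginal.
    For q both terms of the ratio are multiplied by alpha. *)
Lemma tilt_share_Y_X p q (alpha : X -> R) : measurable_fun setT alpha ->
  (forall x, 0 <= alpha x) -> has_density q p (fun z => alpha z.1) ->
  {ae marginalX p, forall x, 0 < alpha x} -> share_Y_X p q.
Proof.
move=> ma a0 dq a_gt0.
have [f df] := has_density_exists (ac_dominated p).
have [k dk] := has_density_exists (@marginalX_dominated _ _ _ _ _ _ _ p).
have dqX := has_density_trans (marginalX_tilt dq ma a0) dk.
have dqf := has_density_trans dq df.
have ka := has_density_ae dk a_gt0.
have pE := density_ae dk; have qE := density_ae dqX.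
have pk := ae_marginalX (has_density_gt0 dk).
have qk := ae_marginalX (has_density_gt0 dqX).
have rp := density_ratio df (prod_densityX muY dk)
  (dominated_by_marginal (ac_dominated p) (prod_densityX muY dk) pk).
have rq := density_ratio dqf (prod_densityX muY dqX)
  (dominated_by_marginal (ac_dominated q) (prod_densityX muY dqX) qk).
split.
  apply: filterS2 (filterI pE qE) ka => x [px qx] kax.
  rewrite /SX/= /phiX px qx; split => [kx|]; first by rewrite mulr_gt0// kax.
  have k0 : 0 <= k x by case: dk.
  by apply: contraTT; rewrite -!leNgt => kx; rewrite mulr_ge0_le0.
apply: filterS2 (filterI rp rq) (filterI (ae_fst muY pE) (ae_fst muY ka)).
move=> z [rpz rqz] [pz kaz] [+ _]; rewrite /SX/= /phiX pz => kz.
have az := kaz kz; rewrite /phiY_X rpz// rqz ?mulr_gt0//.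
by field; rewrite !gt_eqF.
Qed.

Lemma tilt_share_X_Y p q (beta : Y -> R) : measurable_fun setT beta ->
  (forall y, 0 <= beta y) -> has_density q p (fun z => beta z.2) ->
  {ae marginalY p, forall y, 0 < beta y} -> share_X_Y p q.
Proof.
move=> mb b0 dq b_gt0.
have [f df] := has_density_exists (ac_dominated p).
have [k dk] := has_density_exists (@marginalY_dominated _ _ _ _ _ _ _ p).
have dqY := has_density_trans (marginalY_tilt dq mb b0) dk.
have dqf := has_density_trans dq df.
have kb := has_density_ae dk b_gt0.
have pE := density_ae dk; have qE := density_ae dqY.
have pk := ae_marginalY (has_density_gt0 dk).
have qk := ae_marginalY (has_density_gt0 dqY).
have rp := density_ratio df (prod_densityY muX dk)
  (dominated_by_marginal (ac_dominated p) (prod_densityY muX dk) pk).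
have rq := density_ratio dqf (prod_densityY muX dqY)
  (dominated_by_marginal (ac_dominated q) (prod_densityY muX dqY) qk).
split.
  apply: filterS2 (filterI pE qE) kb => y [py qy] kby.
  rewrite /SY/= /phiY py qy; split => [ky|]; first by rewrite mulr_gt0// kby.
  have k0 : 0 <= k y by case: dk.
  by apply: contraTT; rewrite -!leNgt => ky; rewrite mulr_ge0_le0.
apply: filterS2 (filterI rp rq) (filterI (ae_snd muX pE) (ae_snd muX kb)).
move=> z [rpz rqz] [pz kbz] [_ +]; rewrite /SY/= /phiY pz => kz.
have bz := kbz kz; rewrite /phiX_Y rpz// rqz ?mulr_gt0//.
by field; rewrite !gt_eqF.
Qed.

Section Tilt.
Context d (T : measurableType d) (P : probability T R) (h : T -> R).
Hypotheses (mh : measurable_fun setT h) (h0 : forall x, 0 <= h x).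
Hypothesis h1 : (\int[P]_x (h x)%:E = 1)%E.

Let tilt (A : set T) : \bar R := (\int[P]_(x in A) (h x)%:E)%E.

Let tilt0 : tilt set0 = 0%E. Proof. exact: integral_set0. Qed.
Let tilt_ge0 A : (0 <= tilt A)%E.
Proof. by apply: integral_ge0 => x _; rewrite lee_fin. Qed.
Let tilt_sigma_additive : semi_sigma_additive tilt.
Proof.
apply: semi_sigma_additive_nng_induced; first exact/measurable_EFinP.
by move=> x; rewrite lee_fin.
Qed.

HB.instance Definition _ := isMeasure.Build _ _ _ tilt
  tilt0 tilt_ge0 tilt_sigma_additive.
HB.instance Definition _ := Measure_isProbability.Build _ _ _ tilt h1.

Lemma probability_of_density : exists Q : probability T R, has_density Q P h.
Proof. by exists tilt. Qed.

End Tilt.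

End SameDependence.

(** * Reweighting both coordinates preserves the dependence *)

Section ProductDensity.
Context d1 d2 (X : measurableType d1) (Y : measurableType d2) (R : realType).
Variables (muX : {finite_measure set X -> \bar R})
          (muY : {finite_measure set Y -> \bar R}).
Local Notation muXY := (prod_measure muX muY).
Implicit Types (p q : ac_distribution muX muY).

Lemma ae_to_marginalY (Q : probability (X * Y)%type R) (b : Y -> R) :
  measurable_fun setT b ->
  {ae Q, forall z, 0 < b z.2} -> {ae marginalY Q, forall y, 0 < b y}.
Proof.
move=> mb Qb; pose N := [set y | b y <= 0].
have mN : measurable N.
  have -> : N = b @^-1` `]-oo, 0]%classic by apply/seteqP; split => y; rewrite /N/= in_itv.
  by rewrite -[X in measurable X]setTI; apply: mb.
exists N; split => //; last by move=> y /= /negP; rewrite -leNgt.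
rewrite marginalY_E; apply: contrapT => /eqP N0.
apply: (@ae_not_null _ _ _ Q (setT `*` N)).
- exact: measurableX.
- by rewrite lt_neqAle eq_sym N0 measure_ge0.
- by apply: filterS Qb => z bz [_]; rewrite /N/= leNgt bz.
Qed.

(** The intermediate distribution q' = alpha p / c, where c is the integral of
    alpha, shares the Y|X-density of p and the X|Y-density of q. *)
Lemma dep_product_density (D : Type) (dep : ac_distribution muX muY -> D)
    p q (alpha : X -> R) (beta : Y -> R) :
  is_dependence dep ->
  measurable_fun setT alpha -> measurable_fun setT beta ->
  (forall x, 0 <= alpha x) -> (forall y, 0 <= beta y) ->
  {ae marginalX p, forall x, 0 < alpha x} ->
  {ae marginalY p, forall y, 0 < beta y} ->
  (\int[marginalX p]_x (alpha x)%:E < +oo)%E ->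
  has_density q p (fun z => alpha z.1 * beta z.2) -> dep p = dep q.
Proof.
move=> hdep ma mb a0 b0 a_gt0 b_gt0 afin dq.
have ma1 : measurable_fun setT (fun z : X * Y => alpha z.1) by exact: (measurableT_comp ma).
have mb2 : measurable_fun setT (fun z : X * Y => beta z.2) by exact: (measurableT_comp mb).
have aE : (\int[p]_z (alpha z.1)%:E = \int[marginalX p]_x (alpha x)%:E)%E.
  apply/esym; apply: (ge0_integral_pushforward (phi := fst) measurable_fst) => //.
    exact/measurable_EFinP.
  by move=> x _; rewrite lee_fin.
have pa := ae_marginalX a_gt0; have pb := ae_marginalY b_gt0.
pose c := fine (\int[p]_z (alpha z.1)%:E)%E.
have c0 : (0 <= \int[p]_z (alpha z.1)%:E)%E.
  by apply: integral_ge0 => z _; rewrite lee_fin.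
have cE : (\int[p]_z (alpha z.1)%:E = c%:E)%E.
  by rewrite /c fineK// ge0_fin_numE// aE.
have c_gt0 : 0 < c.
  rewrite lt_neqAle fine_ge0// andbT eq_sym; apply/eqP => c00.
  have : (\int[p]_z `|(alpha z.1)%:E| = 0)%E.
    apply: (@etrans _ _ c%:E); last by rewrite c00.
    by rewrite -cE; apply: eq_integral => z _; rewrite gee0_abs ?lee_fin.
  move/(ae_eq_integral_abs p measurableT) => /(_ _)/wrap[].
    exact/measurable_EFinP.
  move=> a00; apply: (@ae_not_null _ _ _ p setT) => //.
    by rewrite [X in (_ < X)%E](probability_setT p).
  by apply: filterS2 pa a00 => z az /(_ I)[] az0 _; rewrite az0 ltxx in az.
pose h (z : X * Y) := alpha z.1 / c.
have mh : measurable_fun setT h by apply: measurable_funM.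
have h0 z : 0 <= h z by rewrite /h divr_ge0// ltW.
have h1 : (\int[p]_z (h z)%:E = 1)%E.
  under eq_integral do rewrite /h EFinM.
  rewrite ge0_integralZr//.
  - by rewrite cE -EFinM divff// gt_eqF.
  - exact/measurable_EFinP.
  - by move=> z _; rewrite lee_fin.
  - by rewrite lee_fin invr_ge0 ltW.
have [Q dQ] := probability_of_density mh h0 h1.
have Qmu : Q `<< muXY.
  exact: null_dominates_trans (has_density_dominates dQ) (ac_dominated p).
pose q' := AcDistribution Qmu.
have -> : dep p = dep q'.
  apply: (dep_conditional hdep); left.
  apply: (@tilt_share_Y_X _ _ _ _ _ _ _ p q' (fun x => alpha x / c)) => //.
  - exact: measurable_funM.
  - by move=> x; rewrite divr_ge0// ltW.
  - by apply: filterS a_gt0 => x ax; rewrite divr_gt0.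
apply: (dep_conditional hdep); right.
apply: (@tilt_share_X_Y _ _ _ _ _ _ _ q' q (fun y => c * beta y)) => //.
- exact: measurable_funM.
- by move=> y; rewrite mulr_ge0// ltW.
- split.
  + exact: measurable_funM.
  + by move=> z; rewrite mulr_ge0// ltW.
  + move=> A mA; case: dq => _ _ qE; apply: etrans (qE A mA) _.
    apply/esym; apply: etrans (change_of_density dQ mA _ _) _.
    * by apply: measurable_funTS; apply/measurable_EFinP; exact: measurable_funM.
    * by move=> z; rewrite lee_fin mulr_ge0// ltW.
    apply: eq_integral => z _; rewrite -EFinM /h; congr EFin.
    by field; rewrite gt_eqF.
- apply: ae_to_marginalY; first exact: measurable_funM.
  have Qb := ae_dominates (has_density_dominates dQ) pb.
  by apply: filterS Qb => z bz; rewrite mulr_gt0.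
Qed.

Lemma tonelli_prod (a : X -> R) (b : Y -> R) :
  measurable_fun setT a -> measurable_fun setT b ->
  (forall x, 0 <= a x) -> (forall y, 0 <= b y) ->
  (\int[muXY]_z (a z.1 * b z.2)%:E =
   (\int[muX]_x (a x)%:E) * (\int[muY]_y (b y)%:E))%E.
Proof.
move=> ma mb a0 b0.
apply: etrans (@fubini_tonelli1 _ _ _ _ _ muX muY _ _ _) _.
- apply/measurable_EFinP; apply: measurable_funM.
    exact: (measurableT_comp ma).
  exact: (measurableT_comp mb).
- by move=> z; rewrite lee_fin mulr_ge0.
rewrite -ge0_integralZr//; last 3 first.
- exact/measurable_EFinP.
- by move=> x _; rewrite lee_fin.
- by apply: integral_ge0 => y _; rewrite lee_fin.
apply: eq_integral => x _; rewrite /fubini_F/=.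
under eq_integral do rewrite EFinM.
rewrite ge0_integralZl_EFin//.
- by move=> y _; rewrite lee_fin.
- exact/measurable_EFinP.
Qed.

Lemma lty_factor (a b : \bar R) : (0 <= a -> 0 < b -> a * b < +oo -> a < +oo)%E.
Proof.
by move=> a0 b0; rewrite !ltey; apply: contra_neq => ->; rewrite gt0_mulye.
Qed.

(** On E x F the mass of f a b is at least c times that of a b, which is the
    product of two integrals. *)
Lemma rectangle_factors (f : X * Y -> R) (c : R) (E : set X) (F : set Y)
    (a : X -> R) (b : Y -> R) :
  measurable_fun setT f -> (forall z, 0 <= f z) -> 0 < c ->
  measurable E -> measurable F ->
  {ae muXY, forall z, E z.1 -> F z.2 -> c <= f z} ->
  measurable_fun setT a -> measurable_fun setT b ->
  (forall x, 0 < a x) -> (forall y, 0 < b y) ->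
  (\int[muXY]_z (f z * (a z.1 * b z.2))%:E < +oo)%E ->
  ((\int[muX]_x (a x * \1_E x)%:E) * (\int[muY]_y (b y * \1_F y)%:E) < +oo)%E.
Proof.
move=> mf f0 c0 mE mF fEF ma mb a0 b0 fin.
have ma' : measurable_fun setT (fun x => a x * \1_E x) by apply: measurable_funM.
have mb' : measurable_fun setT (fun y => b y * \1_F y) by apply: measurable_funM.
have ma1 : measurable_fun setT (fun z : X * Y => a z.1) by exact: (measurableT_comp ma).
have mb2 : measurable_fun setT (fun z : X * Y => b z.2) by exact: (measurableT_comp mb).
rewrite -tonelli_prod//; last 2 first.
- by move=> x; rewrite mulr_ge0// ltW.
- by move=> x; rewrite mulr_ge0// ltW.
apply: (@le_lt_trans _ _ (\int[muXY]_z ((c^-1)%:E * (f z * (a z.1 * b z.2))%:E))%E).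
  apply: ae_ge0_le_integral => //.
  - by move=> z _; rewrite lee_fin !mulr_ge0// ltW.
  - apply/measurable_EFinP/measurable_funM.
      exact: (measurableT_comp ma').
    exact: (measurableT_comp mb').
  - by move=> z _; rewrite -EFinM lee_fin !mulr_ge0// ?invr_ge0 ltW.
  - apply: measurable_funeM; apply/measurable_EFinP/measurable_funM => //.
    exact: measurable_funM.
  apply: filterS fEF => z fz _; rewrite -EFinM lee_fin !indicE.
  have ab0 : 0 <= a z.1 * b z.2 by rewrite mulr_ge0// ltW.
  have r0 : 0 <= c^-1 * (f z * (a z.1 * b z.2)).
    by apply: mulr_ge0; [rewrite invr_ge0 ltW|exact: mulr_ge0].
  have [/set_mem Ez|_] := boolP (z.1 \in E); last by rewrite mulr0 mul0r.
  have [/set_mem Fz|_] := boolP (z.2 \in F); last by rewrite !mulr0.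
  rewrite !mulr1 [leRHS]mulrA ler_peMl// mulrC ler_pdivlMr// mul1r.
  exact: fz.
rewrite ge0_integralZl_EFin//.
- by rewrite lte_mul_pinfty// lee_fin invr_ge0 ltW.
- by move=> z _; rewrite lee_fin !mulr_ge0// ltW.
- by apply/measurable_EFinP/measurable_funM => //; exact: measurable_funM.
- by rewrite invr_ge0 ltW.
Qed.

Lemma int_pos_on d (T : measurableType d) (mu : {measure set T -> \bar R})
    (b : T -> R) (F : set T) :
  measurable_fun setT b -> (forall y, 0 < b y) -> measurable F -> (0 < mu F)%E ->
  (0 < \int[mu]_y (b y * \1_F y)%:E)%E.
Proof.
move=> mb b0 mF F0.
have bF0 y : (0 <= (b y * \1_F y)%:E)%E by rewrite lee_fin mulr_ge0// ltW.
rewrite lt_neqAle integral_ge0// andbT eq_sym; apply/eqP => I0.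
have : (\int[mu]_y `|(b y * \1_F y)%:E| = 0)%E.
  by rewrite -[RHS]I0; apply: eq_integral => y _; rewrite gee0_abs.
move/(ae_eq_integral_abs mu measurableT) => /(_ _)/wrap[].
  by apply/measurable_EFinP; exact: measurable_funM.
move=> ae0; apply: (ae_not_null mF F0); apply: filterS ae0 => y /(_ I)[] + Fy.
by rewrite indicE mem_set// mulr1 => by0; have := b0 y; rewrite by0 ltxx.
Qed.

End ProductDensity.

(** * Integrability of the factors *)

Section FactorIntegrable.
Context d1 d2 (X : measurableType d1) (Y : measurableType d2) (R : realType).
Variables (muX : {finite_measure set X -> \bar R})
          (muY : {finite_measure set Y -> \bar R}).
Local Notation muXY := (prod_measure muX muY).
Variables (f : X * Y -> R) (c : R) (a : X -> R) (b : Y -> R).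
Hypotheses (bf : bounded_mfun f) (f0 : forall z, 0 <= f z) (c0 : 0 < c).
Hypotheses (ma : measurable_fun setT a) (mb : measurable_fun setT b).
Hypotheses (a0 : forall x, 0 < a x) (b0 : forall y, 0 < b y).
Hypothesis fin : (\int[muXY]_z (f z * (a z.1 * b z.2))%:E < +oo)%E.

Let mf : measurable_fun setT f. Proof. by case: bf. Qed.

(** On each E_i the factor a is integrable because b has a positive integral on
    F_i; the E_i cover the places where f charges X, and f is bounded. *)
Lemma left_factor_integrable m (E : 'I_m -> set X) (F : 'I_m -> set Y) :
  (forall i, measurable (E i)) -> (forall i, measurable (F i)) ->
  (forall i, (0 < muY (F i))%E) ->
  (forall i, {ae muXY, forall z, E i z.1 -> F i z.2 -> c <= f z}) ->
  {ae muXY, forall z, 0 < f z -> (\bigcup_i E i) z.1} ->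
  (\int[muXY]_z (a z.1 * f z)%:E < +oo)%E.
Proof.
move=> mE mF F0 fEF cover; have [M [M0 fM]] := bm_bound bf.
have maE i : measurable_fun setT (fun x => a x * \1_(E i) x) by apply: measurable_funM.
have aE0 i x : 0 <= a x * \1_(E i) x by rewrite mulr_ge0// ltW.
have finE i : (\int[muX]_x (a x * \1_(E i) x)%:E < +oo)%E.
  apply: (@lty_factor _ _ (\int[muY]_y (b y * \1_(F i) y)%:E)%E).
  - by apply: integral_ge0 => x _; rewrite lee_fin.
  - exact: int_pos_on (mF i) (F0 i).
  - exact: (rectangle_factors mf f0 c0).
pose F' i (z : X * Y) := (a z.1 * \1_(E i) z.1 * M)%:E.
have mF' i : measurable_fun setT (F' i).
  by apply/measurable_EFinP/measurable_funM => //; exact: (measurableT_comp (maE i)).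
have F'0 i z : (0 <= F' i z)%E by rewrite lee_fin mulr_ge0// ltW.
apply: (@le_lt_trans _ _ (\int[muXY]_z (\sum_i F' i z))%E).
  apply: ae_ge0_le_integral => //.
  - by move=> z _; rewrite lee_fin mulr_ge0// ltW.
  - by apply/measurable_EFinP/measurable_funM => //; exact: (measurableT_comp ma).
  - by move=> z _; apply: sume_ge0 => i _; exact: F'0.
  - exact: emeasurable_sum.
  apply: filterS cover => z fz _; rewrite sumEFin lee_fin.
  have s0 (i : 'I_m) : 0 <= a z.1 * \1_(E i) z.1 * M by rewrite mulr_ge0// ltW.
  have [/fz[i _ Ei]|fz0] := ltP 0 (f z); last first.
    have -> : f z = 0 by apply/eqP; rewrite eq_le fz0 f0.
    by rewrite mulr0 sumr_ge0.
  rewrite (bigD1 i)//= -[leLHS]addr0 lerD//; last by apply: sumr_ge0 => j _.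
  rewrite indicE mem_set// mulr1 ler_wpM2l// ?(ltW (a0 _))//.
  exact: le_trans (ler_norm _) (fM z).
rewrite ge0_integral_sum//; apply: lte_sum_pinfty => i _.
rewrite (@tonelli_prod _ _ _ _ _ muX muY (fun x => a x * \1_(E i) x) (fun=> M))//; last first.
  by move=> _; exact: ltW.
rewrite lte_mul_pinfty//.
- by apply: integral_ge0 => x _; rewrite lee_fin.
- by rewrite ge0_fin_numE//; apply: integral_ge0 => x _; rewrite lee_fin.
- by rewrite integral_cst// lte_mul_pinfty// ?lee_fin ?ltW// ltey_eq fin_num_measure.
Qed.

Lemma right_factor_integrable n (G : 'I_n -> set X) (H : 'I_n -> set Y) :
  (forall j, measurable (G j)) -> (forall j, measurable (H j)) ->
  (forall j, (0 < muX (G j))%E) ->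
  (forall j, {ae muXY, forall z, G j z.1 -> H j z.2 -> c <= f z}) ->
  {ae muXY, forall z, 0 < f z -> (\bigcup_j H j) z.2} ->
  (\int[muXY]_z (b z.2 * f z)%:E < +oo)%E.
Proof.
move=> mG mH G0 fGH cover; have [M [M0 fM]] := bm_bound bf.
have mbH j : measurable_fun setT (fun y => b y * \1_(H j) y) by apply: measurable_funM.
have bH0 j y : 0 <= b y * \1_(H j) y by rewrite mulr_ge0// ltW.
have finH j : (\int[muY]_y (b y * \1_(H j) y)%:E < +oo)%E.
  apply: (@lty_factor _ _ (\int[muX]_x (a x * \1_(G j) x)%:E)%E).
  - by apply: integral_ge0 => x _; rewrite lee_fin.
  - exact: int_pos_on (mG j) (G0 j).
  - by rewrite muleC; exact: (rectangle_factors mf f0 c0).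
pose F' j (z : X * Y) := (M * (b z.2 * \1_(H j) z.2))%:E.
have mF' j : measurable_fun setT (F' j).
  by apply/measurable_EFinP/measurable_funM => //; exact: (measurableT_comp (mbH j)).
have F'0 j z : (0 <= F' j z)%E by rewrite lee_fin mulr_ge0// ltW.
apply: (@le_lt_trans _ _ (\int[muXY]_z (\sum_j F' j z))%E).
  apply: ae_ge0_le_integral => //.
  - by move=> z _; rewrite lee_fin mulr_ge0// ltW.
  - by apply/measurable_EFinP/measurable_funM => //; exact: (measurableT_comp mb).
  - by move=> z _; apply: sume_ge0 => i _; exact: F'0.
  - exact: emeasurable_sum.
  apply: filterS cover => z fz _; rewrite sumEFin lee_fin.
  have s0 (j : 'I_n) : 0 <= M * (b z.2 * \1_(H j) z.2) by rewrite mulr_ge0// ltW.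
  have [/fz[j _ Hj]|fz0] := ltP 0 (f z); last first.
    have -> : f z = 0 by apply/eqP; rewrite eq_le fz0 f0.
    by rewrite mulr0 sumr_ge0.
  rewrite (bigD1 j)//= -[leLHS]addr0 lerD//; last by apply: sumr_ge0 => i _.
  rewrite indicE mem_set// mulr1 mulrC ler_wpM2r// ?(ltW (b0 _))//.
  exact: le_trans (ler_norm _) (fM z).
rewrite ge0_integral_sum//; apply: lte_sum_pinfty => j _.
rewrite (@tonelli_prod _ _ _ _ _ muX muY (fun=> M) (fun y => b y * \1_(H j) y))//; last first.
  by move=> _; exact: ltW.
rewrite muleC lte_mul_pinfty//.
- by apply: integral_ge0 => x _; rewrite lee_fin.
- by rewrite ge0_fin_numE//; apply: integral_ge0 => x _; rewrite lee_fin.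
- by rewrite integral_cst// lte_mul_pinfty// ?lee_fin ?ltW// ltey_eq fin_num_measure.
Qed.

End FactorIntegrable.

Lemma Lfun_oo_bounded d (T : measurableType d) (R : realType)
    (mu : {measure set T -> \bar R}) (f : T -> R) :
  f \in Lfun mu +oo%E -> exists M, {ae mu, forall x, `|f x| <= M}.
Proof.
move=> /andP[_]; rewrite inE/= /finite_norm unlock /=; case: ifPn => [_|].
  move=> es; have := ess_sup_ge mu (abse \o (EFin \o f)).
  move: es; case: (ess_sup _ _) => // [r _|_] h.
  - by exists r; apply: filterS h => x /=; rewrite lee_fin.
  - by exists 0; apply: filterS h => x /=; rewrite leeNy_eq.
rewrite -leNgt => mu0 _; exists 0; apply: measure0_ae.
by apply/eqP; rewrite eq_le mu0 measure_ge0.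
Qed.

Section Main.
Context d1 d2 (X : measurableType d1) (Y : measurableType d2) (R : realType).
Variables (muX : {finite_measure set X -> \bar R})
          (muY : {finite_measure set Y -> \bar R}).
Local Notation muXY := (prod_measure muX muY).
Implicit Types (p q : ac_distribution muX muY).

Lemma bounded_density p : phi p \in Lfun muXY +oo%E -> exists f : X * Y -> R,
  [/\ bounded_mfun f, has_density p muXY f & {ae muXY, forall z, phi p z = f z}].
Proof.
move=> /Lfun_oo_bounded[M phiM].
have [k dk] := has_density_exists (ac_dominated p); have [mk k0 pE] := dk.
have phik := density_ae dk.
pose f z := Num.min (k z) `|M|.
have f0 z : 0 <= f z by rewrite le_min k0 normr_ge0.
have kf : {ae muXY, forall z, k z = f z}.
  apply: filterS2 phiM phik => z + kz; rewrite /phi kz => kM.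
  by rewrite /f (min_idPl _)// (le_trans (ler_norm _))// (le_trans kM)// ler_norm.
have mf : measurable_fun setT f by apply: measurable_minr.
exists f; split.
- split=> //; exists `|M| => z; rewrite ger0_norm//.
  by rewrite ge_min lexx orbT.
- split => // A mA; apply: etrans (pE A mA) _; apply: ge0_ae_eq_integral => //.
  + exact: has_density_mEFin dk.
  + by apply: measurable_funTS; apply/measurable_EFinP.
  + by move=> z _; rewrite lee_fin.
  + by move=> z _; rewrite lee_fin.
  + by apply: filterS kf => z ->.
- by apply: filterS2 phik kf => z pz <-.
Qed.

Lemma rectangle_factors_gt0 (E : set X) (F : set Y) :
  measurable E -> measurable F -> (0 < muXY (E `*` F))%E ->
  ((0 < muX E) /\ (0 < muY F))%E.
Proof.
move=> mE mF; have -> : muXY (E `*` F) = (muX E * muY F)%E.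
  exact: (product_measure1E muX muY mE mF).
move=> EF0; split; rewrite lt_neqAle measure_ge0 andbT eq_sym;
  by apply: contraTneq EF0 => ->; rewrite ?mul0e ?mule0 ltxx.
Qed.

(** p gives no mass to the points where the density of its X-marginal is zero. *)
Lemma support_in_SX p f : has_density p muXY f ->
  {ae muXY, forall z, 0 < f z -> SX p z.1}.
Proof.
move=> df; have [k dk] := has_density_exists (@marginalX_dominated _ _ _ _ _ _ _ p).
have pk := has_density_ae df (ae_marginalX (has_density_gt0 dk)).
apply: filterS2 pk (ae_fst muY (density_ae dk)) => z + kz fz => /(_ fz).
by rewrite /SX/= /phiX kz.
Qed.

Lemma support_in_SY p f : has_density p muXY f ->
  {ae muXY, forall z, 0 < f z -> SY p z.2}.
Proof.
move=> df; have [k dk] := has_density_exists (@marginalY_dominated _ _ _ _ _ _ _ p).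
have pk := has_density_ae df (ae_marginalY (has_density_gt0 dk)).
apply: filterS2 pk (ae_snd muX (density_ae dk)) => z + kz fz => /(_ fz).
by rewrite /SY/= /phiY kz.
Qed.

End Main.

(** * The theorem *)

Local Open Scope ereal_scope.
Local Open Scope charge_scope.

Section MainDirections.
Context d1 d2 (X : measurableType d1) (Y : measurableType d2) (R : realType).
Variables (muX : {finite_measure set X -> \bar R})
          (muY : {finite_measure set Y -> \bar R}).
Local Notation muXY := (prod_measure muX muY).
Implicit Types (p q : ac_distribution muX muY).

(** The scaled distribution q' has the dependence of p, hence of q, and the
    marginals of q; a dependence identifies it with q. *)
Lemma same_dependence_factorizes (D : Type) (dep : ac_distribution muX muY -> D)
    p q : is_dependence dep -> Pbar p -> Pbar q -> dep p = dep q ->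
  exists (alpha : X -> R) (beta : Y -> R),
    [/\ alpha \in Lfun (marginalX p) 1, forall x, (0 < alpha x)%R,
        beta \in Lfun (marginalY p) 1, forall y, (0 < beta y)%R
      & has_density q p (fun z => alpha z.1 * beta z.2)%R].
Proof.
move=> hdep [p_oo p_rect _] [q_oo _ _] pq.
have [f [bf df phif]] := bounded_density p_oo.
have [g [bg dg phig]] := bounded_density q_oo.
have [mf f0 pE] := df; have [_ g0 qE] := dg.
have fg : {ae muXY, forall z, (0 < f z)%R <-> (0 < g z)%R}.
  have supp : {ae muXY, forall z, SXY p z <-> SXY q z} := dep_support hdep pq.
  apply: filterS2 supp (filterI phif phig) => z.
  by rewrite /SXY/= => + [pz qz]; rewrite pz qz.
have [m [n [E [F [G [H [c [EF GH [SXE SYH] c0 [cEF cGH]]]]]]]]] := p_rect.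
rewrite /same_set_ae in SXE SYH.
have mE i : measurable (E i) by case: (EF i).
have mF i : measurable (F i) by case: (EF i).
have mG j : measurable (G j) by case: (GH j).
have mH j : measurable (H j) by case: (GH j).
have F0 i : 0 < muY (F i).
  by have [_ _ EF0] := EF i; case: (rectangle_factors_gt0 (mE i) (mF i) EF0).
have G0 j : 0 < muX (G j).
  by have [_ _ GH0] := GH j; case: (rectangle_factors_gt0 (mG j) (mH j) GH0).
have fEF i : {ae muXY, forall z, E i z.1 -> F i z.2 -> (c <= f z)%R}.
  apply: filterS2 cEF phif => z + pz Ez Fz; rewrite -pz; apply.
  by exists i.
have fGH j : {ae muXY, forall z, G j z.1 -> H j z.2 -> (c <= f z)%R}.
  apply: filterS2 cGH phif => z + pz Gz Hz; rewrite -pz; apply.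
  by exists j.
have coverX : {ae muXY, forall z, (0 < f z)%R -> (\bigcup_i E i) z.1}.
  apply: filterS2 (support_in_SX df) (ae_fst muY SXE) => z fz Ez /fz.
  by move/Ez.
have coverY : {ae muXY, forall z, (0 < f z)%R -> (\bigcup_j H j) z.2}.
  apply: filterS2 (support_in_SY df) (ae_snd muX SYH) => z fz Hz /fz.
  by move/Hz.
have cover : {ae muXY, forall z, (0 < f z)%R ->
    (\bigcup_i E i) z.1 /\ (\bigcup_j H j) z.2}.
  by apply: filterS2 coverX coverY => z Ez Hz fz; split; [exact: Ez|exact: Hz].
have [u [v [mu mv scX scY]]] :=
  marginal_scaling bf bg f0 g0 fg c0 mE mF mG mH F0 G0 fEF fGH cover.
pose a x := expR (u x); pose b y := expR (v y).
have ma : measurable_fun setT a by exact: measurableT_comp.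
have mb : measurable_fun setT b by exact: measurableT_comp.
have a0 x : (0 < a x)%R by exact: expR_gt0.
have b0 y : (0 < b y)%R by exact: expR_gt0.
pose h (z : X * Y) := (a z.1 * b z.2)%R.
have mh : measurable_fun setT h.
  by apply: measurable_funM; [exact: (measurableT_comp ma)|exact: (measurableT_comp mb)].
have h0 z : (0 <= h z)%R by rewrite mulr_ge0// ltW.
have hE A : measurable A -> \int[p]_(z in A) (h z)%:E =
    \int[muXY]_(z in A) (f z * expR (u z.1 + v z.2))%:E.
  move=> mA; apply: etrans (change_of_density df mA _ _) _.
  - by apply: measurable_funTS; apply/measurable_EFinP.
  - by move=> z; rewrite lee_fin.
  by apply: eq_integral => z _; rewrite -EFinM mulrC /h expRD.
have h1 : \int[p]_z (h z)%:E = 1.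
  apply: (@etrans _ _ (\int[muXY]_(z in setT `*` setT) (g z)%:E)).
    by rewrite -scX// -hE ?setXTT//.
  rewrite setXTT; apply: etrans (probability_setT q).
  exact/esym/qE.
have [Q dQ] := probability_of_density mh h0 h1.
have Qmu : Q `<< muXY.
  exact: null_dominates_trans (has_density_dominates dQ) (ac_dominated p).
pose q' := AcDistribution Qmu.
have fin : \int[muXY]_z (f z * (a z.1 * b z.2))%:E < +oo.
  apply: (@le_lt_trans _ _ 1); last exact: ltry.
  rewrite -h1 hE// le_eqVlt; apply/orP; left; apply/eqP.
  by apply: eq_integral => z _; rewrite expRD.
have afin : \int[marginalX p]_x (a x)%:E < +oo.
  apply: le_lt_trans (left_factor_integrable bf f0 c0 ma mb a0 b0 fin mE mF F0 fEF coverX).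
  rewrite le_eqVlt; apply/orP; left; apply/eqP.
  apply: etrans (ge0_integral_pushforward (phi := fst) measurable_fst _ _ _ _) _ => //.
  - exact/measurable_EFinP.
  - by move=> x _; rewrite lee_fin ltW.
  apply: etrans (change_of_density df measurableT _ _) _.
  - by apply/measurable_EFinP; exact: (measurableT_comp ma).
  - by move=> z; rewrite lee_fin ltW.
  by apply: eq_integral => z _.
have bfin : \int[marginalY p]_y (b y)%:E < +oo.
  apply: le_lt_trans (right_factor_integrable bf f0 c0 ma mb a0 b0 fin mG mH G0 fGH coverY).
  rewrite le_eqVlt; apply/orP; left; apply/eqP.
  apply: etrans (ge0_integral_pushforward (phi := snd) measurable_snd _ _ _ _) _ => //.
  - exact/measurable_EFinP.
  - by move=> x _; rewrite lee_fin ltW.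
  apply: etrans (change_of_density df measurableT _ _) _.
  - by apply/measurable_EFinP; exact: (measurableT_comp mb).
  - by move=> z; rewrite lee_fin ltW.
  by apply: eq_integral => z _.
have dep_q' : dep p = dep q'.
  apply: (dep_product_density (q := q') hdep ma mb _ _ _ _ afin dQ).
  - by move=> x; exact: ltW.
  - by move=> y; exact: ltW.
  - exact: aeW.
  - exact: aeW.
have q'q : same_measure q' q.
  apply: (dep_identifies hdep (rho := marginalX q) (sigma := marginalY q)).
  - split=> A mA.
      rewrite [LHS]marginalX_E [RHS]marginalX_E.
      have mAT : measurable (A `*` [set: Y]) by exact: measurableX.
      have [_ _ QE] := dQ.
      apply: etrans (QE _ mAT) _; apply: etrans (hE _ mAT) _.
      by rewrite scX//; exact/esym/qE.
    rewrite [LHS]marginalY_E [RHS]marginalY_E.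
    have mAT : measurable ([set: X] `*` A) by exact: measurableX.
    have [_ _ QE] := dQ.
    apply: etrans (QE _ mAT) _; apply: etrans (hE _ mAT) _.
    by rewrite scY//; exact/esym/qE.
  - by split.
  - by rewrite -dep_q'.
exists a, b; split => //.
- apply/Lfun1_integrable/integrableP; split; first exact/measurable_EFinP.
  by under eq_integral do rewrite gee0_abs ?lee_fin ?ltW//.
- apply/Lfun1_integrable/integrableP; split; first exact/measurable_EFinP.
  by under eq_integral do rewrite gee0_abs ?lee_fin ?ltW//.
- split => // A mA; have [_ _ QE] := dQ.
  by apply: etrans (QE A mA); apply/esym; exact: q'q.
Qed.

(** The factors are positive almost everywhere only; their absolute values are
    nonnegative everywhere and give the same product p-almost everywhere. *)
Lemma factorizes_same_dependence (D : Type) (dep : ac_distribution muX muY -> D)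
    p q (alpha : X -> R) (beta : Y -> R) : is_dependence dep ->
  (q : probability (X * Y)%type R) `<< (p : probability (X * Y)%type R) ->
  alpha \in Lfun (marginalX p) 1 ->
  {ae marginalX p, forall x, (0 < alpha x)%R} ->
  measurable_fun setT beta ->
  {ae marginalY p, forall y, (0 < beta y)%R} ->
  {ae (p : probability (X * Y)%type R), forall z,
    'd (charge_of_finite_measure q) '/d p z = (alpha z.1 * beta z.2)%:E} ->
  dep p = dep q.
Proof.
move=> hdep qp La a_gt0 mb b_gt0 dqp.
have /Lfun1_integrable/integrableP[/measurable_EFinP ma afin] := La.
have ma' : measurable_fun setT (fun x => `|alpha x|%R) by exact: measurableT_comp.
have mb' : measurable_fun setT (fun y => `|beta y|%R) by exact: measurableT_comp.
apply: (@dep_product_density _ _ _ _ _ _ _ _ dep p q (fun x => `|alpha x|)%R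
    (fun y => `|beta y|)%R) => //.
- by apply: filterS a_gt0 => x ax; rewrite gtr0_norm.
- by apply: filterS b_gt0 => y bY; rewrite gtr0_norm.
have mab : measurable_fun setT (fun z : X * Y => `|alpha z.1| * `|beta z.2|)%R.
  by apply: measurable_funM; [exact: (measurableT_comp ma')|exact: (measurableT_comp mb')].
split => // A mA.
have RN := @Radon_Nikodym_integral _ _ _ (charge_of_finite_measure q) p A qp mA.
apply: etrans RN _.
apply: ae_eq_integral => //.
- by apply: measurable_funTS; apply: (measurable_int p); exact: Radon_Nikodym_integrable.
- by apply: measurable_funTS; apply/measurable_EFinP.
- apply: filterS2 dqp (filterI (ae_marginalX a_gt0) (ae_marginalY b_gt0)).
  by move=> z -> [az bz] _; rewrite !gtr0_norm.
Qed.

End MainDirections.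

Theorem theorem4p1 (d1 d2 : measure_display) (X : measurableType d1)
    (Y : measurableType d2) (R : realType)
    (muX : {finite_measure set X -> \bar R})
    (muY : {finite_measure set Y -> \bar R})
    (D : Type) (dep : ac_distribution muX muY -> D)
    (dep_is_dependence : is_dependence dep)
    (p pstar : ac_distribution muX muY)
    (p_Pbar : Pbar p) (pstar_Pbar : Pbar pstar) :
  dep p = dep pstar <->
  (pstar : probability (X * Y)%type R) `<< (p : probability (X * Y)%type R) /\
  exists (alpha : X -> R) (beta : Y -> R),
    [/\ alpha \in Lfun (marginalX p) 1,
        {ae marginalX p, forall x, (0 < alpha x)%R},
        beta \in Lfun (marginalY p) 1,
        {ae marginalY p, forall y, (0 < beta y)%R}
      & {ae (p : probability (X * Y)%type R), forall z,
          'd (charge_of_finite_measure pstar) '/d p z =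
            (alpha z.1 * beta z.2)%:E}].
Proof.
split=> [same_dep|[ac [alpha [beta [La a_gt0 Lb b_gt0 dE]]]]].
  have [alpha [beta [La a_gt0 Lb b_gt0 dq]]] :=
    same_dependence_factorizes dep_is_dependence p_Pbar pstar_Pbar same_dep.
  split; first exact: has_density_dominates dq.
  exists alpha, beta; split => //; [exact: aeW|exact: aeW|exact: RN_ae].
have /Lfun1_integrable/integrableP[/measurable_EFinP mb _] := Lb.
exact: factorizes_same_dependence dep_is_dependence ac La a_gt0 mb b_gt0 dE.
Qed.
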